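(* Let $A$ be a partially fundamentally reducible relation on a Krein space $\mathcal{K}$. Then $\sigma(A)\cap(\mathbb{C}\setminus\mathbb{R})$ is a discrete set in $\mathbb{C}\setminus\mathbb{R}$. Moreover, if $(\mathcal{K},A,v)$ is a realization of a function $q$ with base point $\zeta_0\in\varrho(A)$, then $q$ is an element of $\mathcal{N}_{sym}$.
   Context: $\mathbb{C}^+$ and $\mathbb{C}^-$ are the open upper and lower half-planes, and $\mathcal{H}^\infty(\mathbb{C}^{+})$ is the space of bounded analytic functions on $\mathbb{C}^+$. $\mathcal{N}(\mathbb{C}^+)$ is the set of meromorphic functions on $\mathbb{C}^+$ of the form $f_1/f_2$ with $f_1,f_2\in\mathcal{H}^\infty(\mathbb{C}^+)$, $f_2\not\equiv 0$; $\mathcal{N}(\mathbb{C}^-)$ is defined analogously. $\mathcal{N}_{sym}$ is the set of meromorphic functions $f$ on $\mathbb{C}\setminus\mathbb{R}$ with $f_{|\mathbb{C}^+}\in\mathcal{N}(\mathbb{C}^+)$, $f_{|\mathbb{C}^-}\in\mathcal{N}(\mathbb{C}^-)$ and $f(\overline{\zeta})=\overline{f(\zeta)}$. A Krein space is a complex vector space $\mathcal{K}$ with a sesquilinear form that has a direct orthogonal decomposition $\mathcal{K}=\mathcal{K}_+[+]\mathcal{K}_-$ (a fundamental decomposition) such that $\mathcal{K}_+$ and $-\mathcal{K}_-:=(\mathcal{K}_-,-[\cdot,\cdot])$ are Hilbert spaces; it carries the Hilbert space topology of $\mathcal{K}_+\oplus(-\mathcal{K}_-)$. A relation is a linear subspace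 $A\subset\mathcal{K}\times\mathcal{K}$, with adjoint $A^+=\{(u,v):[u,y]=[v,x]\ \forall(x,y)\in A\}$; $A$ is self-adjoint if $A=A^+$, and symmetric if $A\subset A^+$. $\varrho(A)$ and $\sigma(A)$ are the resolvent set and the spectrum. A self-adjoint relation $A$ in $\mathcal{K}$ with $\varrho(A)\ne\emptyset$ is partially fundamentally reducible if there is a fundamental decomposition $\mathcal{K}=\mathcal{K}_+[+]\mathcal{K}_-$ such that $S_+:=A\cap(\mathcal{K}_+\times\mathcal{K}_+)$ and $S_-:=A\cap(\mathcal{K}_-\times\mathcal{K}_-)$ are closed, simple symmetric operators on the Hilbert spaces $\mathcal{K}_+$ and $-\mathcal{K}_-$ with deficiency index $(1,1)$. Here operators are identified with their graphs and need not be densely defined; the deficiency index of $S$ is $(\dim\ker(S^+-\mathrm{i}),\dim\ker(S^++\mathrm{i}))$; and $S$ is simple if there is no non-trivial orthogonal decomposition $\mathcal{H}=\mathcal{H}_1\oplus\mathcal{H}_2$ of the Hilbert space for which $S=S_1\oplus S_2$ with $S_2$ self-adjoint in $\mathcal{H}_2$. $(\mathcal{K},A,v)$, with $A$ self-adjoint in $\mathcal{K}$, $\varrho(A)\neq\emptyset$ and $v\in\mathcal{K}$, is a realization of an analytic function $q$ on $U\subset\mathbb{C}$ with base point $\zeta_0\in\varrho(A)\cap U$ if $q(\zeta)=\overline{q(\zeta_0)}+(\zeta-\overline{\zeta_0})[(I+(\zeta-\zeta_0)(A-\zeta)^{-1})v,v]_{\mathcal{K}}$ for all $\zeta\in\varrho(A)\cap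 U$. The function $q$ is extended to the whole of $\varrho(A)$ by the right-hand side of this formula if necessary, and $q\in\mathcal{N}_{sym}$ refers to this extended function. *)

(* Defs.v *)
From HB Require Import structures.
From mathcomp Require Import all_boot all_order all_algebra.
From mathcomp Require Import all_classical all_reals all_analysis.
From mathcomp Require Import complex.
Set Implicit Arguments.
Unset Strict Implicit.
Unset Printing Implicit Defensive.
Import Order.TTheory GRing.Theory Num.Theory.
Import numFieldNormedType.Exports.
Local Open Scope classical_set_scope.
Local Open Scope ring_scope.

(* R[i] has no topology of its own in the libraries; it receives the one that
   every numFieldType carries, that is, the metric topology of the modulus. *)
HB.instance Definition _ (R : realType) := NormedModule.copy R[i] R[i]^o.

Section FunctionClasses.
Variable R : realType.
Local Notation C := R[i].
Implicit Types (D U dom S : set C) (f : C -> C).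

Definition upper_half_plane : set C := [set z | 0 < complex.Im z].
Definition lower_half_plane : set C := [set z | complex.Im z < 0].
Definition nonreal : set C := [set z | complex.Im z != 0].

(* S has no accumulation point in D, i.e. S is discrete and relatively closed
   in D (for S relatively closed in D this is the same as being discrete). *)
Definition discrete_in D S := forall z, D z -> ~ limit_point S z.

(* Intended for open U. *)
Definition holomorphic_on U f := forall z, U z -> derivable f z 1.

Definition bounded_holomorphic D f :=
  holomorphic_on D f /\ [bounded f z | z in D].

(* f is holomorphic near p, or has at p a removable singularity or a pole (of
   order at most n). *)
Definition pole_or_removable f (p : C) :=
  exists (n : nat) (g : C -> C),
    (\forall z \near p, derivable g z 1) /\
    (\forall z \near p^', f z = g z / (z - p) ^+ n).

(* A meromorphic function on the open set D is represented by a set dom and a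
   function f of which only the values on dom are meaningful; the points of D
   outside dom form a discrete set and are poles or removable singularities. *)
Definition meromorphic_on D dom f :=
  [/\ open (D `&` dom), holomorphic_on (D `&` dom) f,
      discrete_in D (D `\` dom) &
      forall p, D p -> ~ dom p -> pole_or_removable f p].

(* N(D): quotients of bounded holomorphic functions on D. *)
Definition bounded_type D dom f :=
  meromorphic_on D dom f /\
  exists f1 f2 : C -> C,
    [/\ bounded_holomorphic D f1, bounded_holomorphic D f2,
        (exists2 z, D z & f2 z != 0) &
        forall z, D z -> dom z -> f2 z != 0 -> f z = f1 z / f2 z].

Definition N_sym dom f :=
  [/\ meromorphic_on nonreal dom f,
      bounded_type upper_half_plane dom f,
      bounded_type lower_half_plane dom f &
      forall z, nonreal z -> dom z -> dom z^* -> f z^* = (f z)^*].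

End FunctionClasses.

Section Spaces.
Variables (R : realType) (K : lmodType R[i]).
Local Notation C := R[i].
(* ip stands for a hermitian form on K or for its opposite *)
Implicit Types (ip : K -> K -> C) (H X Y : set K) (A S T : set (K * K)).

Definition is_subspace (V : lmodType C) (S : set V) :=
  S 0 /\ forall (a : C) u v, S u -> S v -> S (a *: u + v).

Definition has_dim X (n : nat) :=
  exists b : 'I_n -> K,
    [/\ forall i, X (b i),
        forall c : 'I_n -> C, \sum_i c i *: b i = 0 -> forall i, c i = 0 &
        forall x, X x -> exists c : 'I_n -> C, x = \sum_i c i *: b i].

Definition opp_form ip : K -> K -> C := fun x y => - ip x y.

Definition orthogonal_decomposition ip H X Y :=
  [/\ is_subspace X, is_subspace Y, H = [set x + y | x in X & y in Y],
      X `&` Y = [set 0] & forall x y, X x -> Y y -> ip x y = 0].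

Definition form_norm ip (x : K) : R := Num.sqrt (complex.Re (ip x x)).

Definition hilbert_on ip H :=
  [/\ is_subspace H, forall x, H x -> x != 0 -> 0 < ip x x &
      forall u : nat -> K, (forall n, H (u n)) ->
        (forall e : R, 0 < e -> exists N : nat, forall m n : nat,
           (N <= m)%N -> (N <= n)%N -> form_norm ip (u m - u n) < e) ->
        exists2 l, H l & form_norm ip (u n - l) @[n --> \oo] --> (0 : R)].

Definition fundamental_decomposition ip X Y :=
  [/\ orthogonal_decomposition ip setT X Y, hilbert_on ip X &
      hilbert_on (opp_form ip) Y].

Definition krein_space ip := exists X Y, fundamental_decomposition ip X Y.

Definition proj_along X Y (x : K) : K := xget 0 [set y | X y /\ Y (x - y)].

(* norm of the Hilbert space X (+) (-Y) *)
Definition krein_norm ip X Y (x : K) : R :=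
  let p := proj_along X Y x in
  Num.sqrt (complex.Re (ip p p) - complex.Re (ip (x - p) (x - p))).

(* The choice of the fundamental decomposition is immaterial: any two of them
   give equivalent norms. *)
Definition krein_bounded ip (T : K -> K) :=
  exists X Y, fundamental_decomposition ip X Y /\
    exists M : R, forall x, krein_norm ip X Y (T x) <= M * krein_norm ip X Y x.

Definition is_relation H A := is_subspace A /\ A `<=` H `*` H.

Definition adjoint ip H A : set (K * K) :=
  [set p | [/\ H p.1, H p.2 &
              forall q, A q -> ip p.1 q.2 = ip p.2 q.1]].

Definition self_adjoint ip H A := is_relation H A /\ A = adjoint ip H A.
Definition symmetric_rel ip H A := is_relation H A /\ A `<=` adjoint ip H A.

Definition rel_inv A : set (K * K) := [set p | A (p.2, p.1)].
Definition rel_shift A (z : C) : set (K * K) :=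
  [set p | A (p.1, p.2 + z *: p.1)].
Definition rel_ker A : set K := [set x | A (x, 0)].

Definition is_operator A := forall y, A (0, y) -> y = 0.

Definition closed_rel ip H A :=
  forall (u v : nat -> K) x y, (forall n, A (u n, v n)) -> H x -> H y ->
    form_norm ip (u n - x) @[n --> \oo] --> (0 : R) ->
    form_norm ip (v n - y) @[n --> \oo] --> (0 : R) -> A (x, y).

Definition deficiency_index ip H S (m n : nat) :=
  has_dim (rel_ker (rel_shift (adjoint ip H S) 'i)) m /\
  has_dim (rel_ker (rel_shift (adjoint ip H S) (- 'i))) n.

Definition simple_rel ip H S :=
  forall H1 H2 S1 S2, orthogonal_decomposition ip H H1 H2 ->
    is_relation H1 S1 -> self_adjoint ip H2 S2 ->
    S = [set p + q | p in S1 & q in S2] -> H2 = [set 0].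

Definition closed_simple_symmetric11 ip H S :=
  [/\ symmetric_rel ip H S, is_operator S, closed_rel ip H S,
      simple_rel ip H S & deficiency_index ip H S 1 1].

Definition resolvent_set ip A : set C :=
  [set z | exists T : {linear K -> K},
             rel_inv (rel_shift A z) = [set p | p.2 = T p.1] /\
             krein_bounded ip T].

Definition spectrum ip A : set C := ~` resolvent_set ip A.

(* (A - z)^-1 x; meaningful for z in the resolvent set *)
Definition resolvent A (z : C) (x : K) : K :=
  xget 0 [set y | rel_inv (rel_shift A z) (x, y)].

Definition partially_fundamentally_reducible ip A :=
  [/\ self_adjoint ip setT A, resolvent_set ip A !=set0 &
      exists X Y, [/\ fundamental_decomposition ip X Y,
        closed_simple_symmetric11 ip X (A `&` (X `*` X)) &
        closed_simple_symmetric11 (opp_form ip) Y (A `&` (Y `*` Y))]].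

Definition realization_formula ip A (v : K) (q : C -> C) (z0 z : C) : C :=
  (q z0)^* + (z - z0^*) * ip (v + (z - z0) *: resolvent A z v) v.

Definition is_realization ip A v (U : set C) (q : C -> C) (z0 : C) :=
  [/\ self_adjoint ip setT A, resolvent_set ip A z0, U z0 &
      forall z, resolvent_set ip A z -> U z ->
        q z = realization_formula ip A v q z0 z].

(* the extension of q from U to the union of U and the resolvent set *)
Definition realization_extension ip A v (U : set C) (q : C -> C) (z0 : C) :
    C -> C :=
  fun z => if z \in U then q z else realization_formula ip A v q z0 z.

End Spaces.

(* Main.v *)
Require Import Defs.
From HB Require Import structures.
From mathcomp Require Import all_boot all_order all_algebra.
From mathcomp Require Import all_classical all_reals all_analysis.
From mathcomp Require Import complex ring lra.
Import Order.TTheory GRing.Theory Num.Theory.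
Import numFieldNormedType.Exports.
Local Open Scope classical_set_scope.
Local Open Scope ring_scope.

(* Let <x, y> be the Hilbert space product of the fundamental decomposition and
   let S be the orthogonal sum of S_+ and S_-, a closed symmetric relation with
   deficiency index (2, 2) that A extends.  For e = i or e = - i, let L be the
   defect space Ran(S + e)^perp, spanned by two vectors phi0 and phi1.  The
   relation B = S + {(w, e w) | w in L} satisfies 0 <= Re (e <f, g>) for (f, g)
   in B, so it is maximal dissipative up to a factor, and its resolvent T(z)
   exists on the whole half-plane D containing - e.  Hence e <T(z) x, x> is
   holomorphic with nonnegative real part there, hence a quotient of bounded
   holomorphic functions, and so is each <T(z) x, y> by polarization.
   Writing A = S + span{p0, p1}, solving g - z f = x for (f, g) in A amounts
   to a 2 x 2 linear system whose coefficients are polynomials in z and in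
   such functions, with determinant d: where d is nonzero, z is in the resolvent
   set and, by Cramer's rule, the resolvent of A is a quotient with denominator
   d.  At a point of D where A - z is injective d is nonzero; if m is a nonreal
   point of the resolvent set, then m and its conjugate are such points, one in
   each half-plane.  So the zeros of d, and with them the nonreal spectrum, are
   isolated, and q is a quotient of functions of bounded type. *)

Set Implicit Arguments.
Unset Strict Implicit.
Unset Printing Implicit Defensive.

(** * The modulus *)

Section Modulus.
Context {R : realType}.
Local Notation C := R[i].
Implicit Types (z w p : C) (f g : C -> C).

(** The obstacle is that [A] is self-adjoint only for the indefinite form, so Hilbert space
    estimates do not apply to [A] itself. [S], however, is symmetric for the Hilbert product as
    well, since passing to that product changes only a sign on [Y], and [A] exceeds [S] by just two
    dimensions. So [A] is a finite-rank modification of [B], and whatever the indefinite form can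
    spoil is concentrated in the zeros of one determinant. To exclude that the determinant vanishes
    identically on the half-plane opposite to [m], injectivity at the conjugate of [m] is enough,
    and self-adjointness derives it from surjectivity of [A - m]. The parameter [e] handles both
    half-planes at once. The pairs [p0], [p1] belong to [A] and [S] alone and serve both
    half-planes; only the defect vectors change with [e]. Analyticity comes from the resolvent
    identity, which exhibits the divided differences of a resolvent explicitly, with geometric
    bounds; isolated zeros and the identity theorem rest on these bounds. *)

Definition modc z : R := complex.Re `|z|.

Lemma modcE z : (modc z)%:C%C = `|z|.
Proof. by rewrite /modc normc_def. Qed.

Lemma modc_ge0 z : 0 <= modc z.
Proof. by rewrite -ler0c modcE. Qed.

Lemma modcM z w : modc (z * w) = modc z * modc w.
Proof. by apply: complexI; rewrite rmorphM !modcE normrM. Qed.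

Lemma modcD z w : modc (z + w) <= modc z + modc w.
Proof. by rewrite -lecR rmorphD !modcE ler_normD. Qed.

Lemma modcN z : modc (- z) = modc z.
Proof. by rewrite /modc normrN. Qed.

Lemma modcB z w : modc (z - w) <= modc z + modc w.
Proof. by rewrite -(modcN w) modcD. Qed.

Lemma modc0 : modc 0 = 0.
Proof. by rewrite /modc normr0. Qed.

Lemma modc1 : modc 1 = 1.
Proof. by rewrite /modc normr1. Qed.

Lemma modc_eq0 z : (modc z == 0) = (z == 0).
Proof. by rewrite -(inj_eq (@complexI R)) modcE normr_eq0. Qed.

Lemma modc_gt0 z : (0 < modc z) = (z != 0).
Proof. by rewrite lt0r modc_ge0 modc_eq0 andbT. Qed.

Lemma modcX z n : modc (z ^+ n) = modc z ^+ n.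
Proof. by elim: n => [|n IH]; rewrite ?expr0 ?modc1// !exprS modcM IH. Qed.

Lemma modcV z : modc z^-1 = (modc z)^-1.
Proof. by apply: complexI; rewrite fmorphV !modcE normfV. Qed.

Lemma modcJ z : modc z^* = modc z.
Proof. by rewrite /modc norm_conjC. Qed.

Lemma modc_real (x : R) : modc x%:C%C = `|x|.
Proof. by rewrite /modc normc_def /= expr0n addr0 sqrtr_sqr. Qed.

Lemma conj_real (x : R) : (x%:C%C)^* = x%:C%C :> C.
Proof. by rewrite conj_Creal// complex_real. Qed.

Lemma Re_le_modc z : `|complex.Re z| <= modc z.
Proof. by rewrite -lecR modcE normc_ge_Re. Qed.

Lemma modc_sqr z : modc z ^+ 2 = complex.Re z ^+ 2 + complex.Im z ^+ 2.
Proof. by apply: complexI; rewrite rmorphXn/= modcE -add_Re2_Im2. Qed.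

Lemma modcBC z w : modc (z - w) = modc (w - z).
Proof. by rewrite -modcN opprB. Qed.

(** The norm of [R[i]] takes its values in [R[i]], so balls have complex radii. Real radii allow
    real arithmetic in all later estimates. *)
Lemma near_modcP p (P : set C) :
  (\forall z \near p, P z) <->
  exists2 r : R, 0 < r & forall z, modc (z - p) < r -> P z.
Proof.
split=> [/nbhs_normP[r /= r0 rP]|[r r0 rP]].
  exists (complex.Re r); first by move: r0; rewrite ltcE/= => /andP[].
  move=> z zp; apply: rP; rewrite /= -modcE modcBC.
  by move: r0; rewrite !ltcE/= => /andP[/eqP -> _]; rewrite eqxx.
apply/nbhs_normP; exists r%:C%C; first by rewrite /= ltcR.
by move=> z; rewrite /= -modcE modcBC ltcR; apply: rP.
Qed.

Lemma near_punctured_modcP p (P : set C) :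
  (\forall z \near p^', P z) <->
  exists2 r : R, 0 < r & forall z, z != p -> modc (z - p) < r -> P z.
Proof.
split=> [/near_modcP[r r0 rP]|[r r0 rP]].
  by exists r => // z zp zr; apply: rP.
by apply/near_modcP; exists r => // z zr zp; exact: rP.
Qed.

Lemma continuous_modcP f p :
  {for p, continuous f} <->
  forall e : R, 0 < e -> \forall z \near p, modc (f z - f p) < e.
Proof.
split=> [fp e e0|fp].
  apply: (fp [set w | modc (w - f p) < e]).
  by apply/near_modcP; exists e.
move=> P /near_modcP[e e0 eP]; apply: filterS (fp e e0) => z; exact: eP.
Qed.

Lemma conjC_continuous : continuous (fun z : C => z^*).
Proof.
move=> p; apply/continuous_modcP => e e0; apply/near_modcP; exists e => // z.
by rewrite -rmorphB modcJ.
Qed.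

Lemma eq_of_punctured_nbhs f g p : {for p, continuous f} ->
  {for p, continuous g} -> (\forall z \near p^', f z = g z) -> f p = g p.
Proof.
move=> fc gc /near_punctured_modcP[r r0 fg].
apply/eqP; rewrite -subr_eq0 -modc_eq0; apply/eqP.
apply/le_anti; rewrite modc_ge0 andbT; apply/ler_addgt0Pr => e e0.
rewrite add0r.
have e2 : 0 < e / 2 by rewrite divr_gt0.
have /continuous_modcP/(_ _ e2)/near_modcP[r1 r10 H1] := fc.
have /continuous_modcP/(_ _ e2)/near_modcP[r2 r20 H2] := gc.
pose s := Num.min r (Num.min r1 r2).
have s0 : 0 < s by rewrite !lt_min r0 r10.
have sE : modc (p + (s / 2)%:C%C - p) = s / 2.
  by rewrite addrC addKr modc_real ger0_norm// divr_ge0// ltW.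
have sl : s / 2 < s by lra.
have : s <= r /\ s <= r1 /\ s <= r2 by rewrite !ge_min !lexx !orbT.
move=> [sr [sr1 sr2]].
have zp : p + (s / 2)%:C%C != p.
  by rewrite -subr_eq0 -modc_eq0 sE gt_eqF// divr_gt0.
have := fg _ zp; rewrite sE => /(_ (lt_le_trans sl sr)) fgz.
have := H1 (p + (s / 2)%:C%C); rewrite sE => /(_ (lt_le_trans sl sr1)) h1.
have := H2 (p + (s / 2)%:C%C); rewrite sE => /(_ (lt_le_trans sl sr2)) h2.
set z := p + _ in fgz h1 h2.
have -> : f p - g p = (g z - g p) - (f z - f p) by rewrite fgz; ring.
by apply: le_trans (modcB _ _) _; lra.
Qed.

(** A quadratic remainder is what divided differences deliver: the second one bounds the error of
    the linear approximation. *)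
Lemma derivable_modc f p l (M : R) :
  (\forall z \near p, modc (f z - f p - l * (z - p)) <= M * modc (z - p) ^+ 2) ->
  derivable f p 1.
Proof.
move=> /near_modcP[r r0 fM]; apply/cvg_ex; exists l.
have M1 : 0 < `|M| + 1 by rewrite ltr_pwDr.
move=> P /near_modcP[e e0 eP]; apply/near_punctured_modcP.
exists (Num.min r (e / (`|M| + 1))); first by rewrite lt_min r0 divr_gt0.
move=> h h0; rewrite subr0 lt_min => /andP[hr he]; apply: eP => /=.
have := fM (h + p); rewrite addrK => /(_ hr).
rewrite /GRing.scale/= mulr1.
set y := f (h + p) - f p => H.
have -> : h^-1 * y - l = h^-1 * (y - l * h) by field.
rewrite modcM modcV; apply: le_lt_trans (_ : `|M| * modc h < e).
  rewrite mulrC ler_pdivrMr ?modc_gt0//.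
  apply: le_trans H _; rewrite expr2 mulrA.
  by rewrite !ler_wpM2r ?modc_ge0// ler_norm.
move: he; rewrite ltr_pdivlMr// => he; apply: le_lt_trans he.
by rewrite mulrC ler_wpM2l ?modc_ge0// lerDl.
Qed.

End Modulus.

(** * Local analyticity by iterated divided differences *)

Section Analytic.
Context {R : realType}.
Local Notation C := R[i].
Implicit Types (z w p : C) (f g : C -> C).

(* A replacement for power series expansions that needs no convergence: [F n] is
   the [n]-th divided difference of [f] with all nodes at [p], and the geometric
   bound makes [f] vanish near [p] as soon as all [F n p] do. *)
Definition analytic_at f p := exists (F : nat -> C -> C) (M Q : R), 0 <= Q /\
  \forall z \near p, F 0 z = f z /\
    forall n, F n z = F n p + (z - p) * F n.+1 z /\ modc (F n z) <= M * Q ^+ n.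

Lemma analytic_near f g p : (\forall z \near p, f z = g z) ->
  analytic_at f p -> analytic_at g p.
Proof.
move=> fg [F [M [Q [Q0 HF]]]]; exists F, M, Q; split=> //.
by apply: filterS2 fg HF => z -> [].
Qed.

Lemma analytic_cst (c : C) p : analytic_at (fun=> c) p.
Proof.
exists (fun n _ => if n is 0 then c else 0), (modc c), 1; split=> //.
apply: filterE => z; split=> // -[|n]; rewrite expr1n mulr1 mulr0 addr0//.
by rewrite modc0 modc_ge0.
Qed.

Lemma analytic_id p : analytic_at id p.
Proof.
exists (fun n z => match n with 0 => z | 1 => 1 | _ => 0 end), (modc p + 1), 1.
split=> //; apply/near_modcP; exists 1 => // z z1; split=> //.
have p1 : 0 <= modc p + 1 by rewrite addr_ge0 ?modc_ge0.
case=> [|[|n]]; rewrite expr1n !mulr1 ?mulr0 ?addr0 ?modc0 ?modc1//.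
- split; first by ring.
  by rewrite -[z](subrK p) addrC; apply: le_trans (modcD _ _) _; rewrite lerD2l ltW.
- by split=> //; rewrite lerDr modc_ge0.
Qed.

Lemma analyticD f g p : analytic_at f p -> analytic_at g p ->
  analytic_at (fun z => f z + g z) p.
Proof.
move=> [F [M [Q [Q0 HF]]]] [G [M' [Q' [Q'0 HG]]]].
exists (fun n z => F n z + G n z), (M + M'), (Num.max Q Q').
split; first by rewrite le_max Q0.
apply: filterS2 HF HG => z [-> HF] [-> HG]; split=> // n.
have [FE Fle] := HF n; have [GE Gle] := HG n.
split; first by rewrite {1}FE {1}GE; ring.
have M0 : 0 <= M.
  by have [_] := HF 0%N; rewrite expr0 mulr1; apply: le_trans (modc_ge0 _).
have M'0 : 0 <= M'.
  by have [_] := HG 0%N; rewrite expr0 mulr1; apply: le_trans (modc_ge0 _).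
apply: le_trans (modcD _ _) _; rewrite mulrDl lerD//.
  apply: le_trans Fle _; rewrite ler_wpM2l// lerXn2r ?nnegrE ?le_max ?Q0 ?lexx//.
by apply: le_trans Gle _; rewrite ler_wpM2l// lerXn2r ?nnegrE ?le_max ?Q'0 ?lexx ?orbT.
Qed.

(* The divided differences of a product obey the Leibniz rule
   [(f g)_n = f g_n + \sum_(1 <= j <= n) f_j g_(n - j)(p)]. *)
Lemma analyticM f g p : analytic_at f p -> analytic_at g p ->
  analytic_at (fun z => f z * g z) p.
Proof.
move=> [F [M [Q [Q0 HF]]]] [G [M' [Q' [Q'0 HG]]]].
pose H n z := F 0%N z * G n z + \sum_(j < n) F j.+1 z * G (n - j.+1)%N p.
have [_ HGp] := nbhs_singleton HG.
pose q := Num.max Q Q'.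
have q0 : 0 <= q by rewrite le_max Q0.
(* Each of the [n + 1] terms of the Leibniz sum is at most [M * M' * q ^+ n]; the factor 2 absorbs
   their number, as [n + 1 <= 2 ^ n]. *)
exists H, (M * M'), (2 * q); split; first by rewrite mulr_ge0.
apply: filterS2 HF HG => z [F0 HF] [G0 HG]; split.
  by rewrite /H big_ord0 addr0 F0 G0.
have M0 : 0 <= M.
  by have [_] := HF 0%N; rewrite expr0 mulr1; apply: le_trans (modc_ge0 _).
have M'0 : 0 <= M'.
  by have [_] := HG 0%N; rewrite expr0 mulr1; apply: le_trans (modc_ge0 _).
have Fq n : modc (F n z) <= M * q ^+ n.
  have [_ /le_trans] := HF n; apply.
  by rewrite ler_wpM2l// lerXn2r ?nnegrE ?le_max ?Q0 ?lexx.
have Gq n : modc (G n z) <= M' * q ^+ n.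
  have [_ /le_trans] := HG n; apply.
  by rewrite ler_wpM2l// lerXn2r ?nnegrE ?le_max ?Q'0 ?lexx ?orbT.
have Gpq n : modc (G n p) <= M' * q ^+ n.
  have [_ /le_trans] := HGp n; apply.
  by rewrite ler_wpM2l// lerXn2r ?nnegrE ?le_max ?Q'0 ?lexx ?orbT.
move=> n; split.
  have dF j : (z - p) * F j.+1 z = F j z - F j p.
    by have [{2}-> _] := HF j; ring.
  have dG j : (z - p) * G j.+1 z = G j z - G j p.
    by have [{2}-> _] := HG j; ring.
  rewrite /H big_ord_recl /= subSS subn0 !mulrDr mulr_sumr.
  under [X in _ = _ + (_ + (_ + X))]eq_bigr => i _.
    rewrite mulrA dF /bump /= add1n subSS mulrBl; over.
  rewrite sumrB mulrCA dG mulrA dF; ring.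
apply: (@le_trans _ _ (\sum_(j < n.+1) (M * M') * q ^+ n)).
  rewrite big_ord_recl; apply: le_trans (modcD _ _) _; apply: lerD.
    rewrite modcM; apply: le_trans (ler_pM _ _ (Fq _) (Gq _)) _;
      by rewrite ?modc_ge0// expr0 mulr1 mulrA.
  elim/big_ind2: _ => [|x1 x2 y1 y2 h1 h2|j _]; first by rewrite modc0.
    by apply: le_trans (modcD _ _) _; apply: lerD.
  rewrite modcM; apply: le_trans (ler_pM _ _ (Fq _) (Gpq _)) _; rewrite ?modc_ge0//.
  by rewrite mulrACA -exprD subnKC.
rewrite sumr_const card_ord exprMn [leRHS]mulrCA -[leLHS]mulr_natl.
by rewrite ler_wpM2r ?mulr_ge0 ?exprn_ge0// -natrX ler_nat ltn_expl.
Qed.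

Lemma analyticB f g p : analytic_at f p -> analytic_at g p ->
  analytic_at (fun z => f z - g z) p.
Proof.
move=> fp gp; have := analyticD fp (analyticM (analytic_cst (-1) p) gp).
by apply: analytic_near; apply: filterE => z; rewrite mulN1r.
Qed.

Lemma analytic_derivable f p : analytic_at f p -> derivable f p 1.
Proof.
move=> [F [M [Q [Q0 HF]]]].
apply: (@derivable_modc _ _ _ (F 1%N p) (M * Q ^+ 2)).
have [Fp HFp] := nbhs_singleton HF.
apply: filterS HF => z [Fz HFz].
rewrite -Fz -Fp (HFz 0%N).1 (HFz 1%N).1.
have -> : F 0 p + (z - p) * (F 1 p + (z - p) * F 2 z) - F 0 p - F 1 p * (z - p)
  = F 2 z * (z - p) ^+ 2 by ring.
by rewrite modcM modcX ler_wpM2r ?exprn_ge0 ?modc_ge0// (HFz 2%N).2.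
Qed.

Lemma derivable_continuous_at f p : derivable f p 1 -> {for p, continuous f}.
Proof. by move=> /derivable1_diffP/differentiable_continuous. Qed.

Lemma analytic_continuous f p : analytic_at f p -> {for p, continuous f}.
Proof. by move/analytic_derivable/derivable_continuous_at. Qed.

(** If some [F n p] is nonzero, the first such index [m] is the order of the zero and [F m] is the
    cofactor; the shifted sequence [F (m + n)] shows that the cofactor is again analytic. *)
Lemma analytic_zero f p : analytic_at f p ->
  (\forall z \near p, f z = 0) \/
  exists N g, [/\ analytic_at g p, g p != 0 &
    \forall z \near p, f z = (z - p) ^+ N * g z].
Proof.
move=> [F [M [Q [Q0 HF]]]].
have [_ HFp] := nbhs_singleton HF.
have FE N : (forall k, (k < N)%N -> F k p = 0) ->
    \forall z \near p, f z = (z - p) ^+ N * F N z.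
  move=> F0; apply: filterS HF => z [<- HFz].
  elim: N F0 => [|N IH] F0; first by rewrite expr0 mul1r.
  rewrite IH => [|k kN]; last by rewrite F0// ltnS ltnW.
  by rewrite (HFz N).1 F0// add0r exprSr mulrA.
have [F0|/existsNP[N /eqP FN]] := pselect (forall k, F k p = 0).
  left; move: HF => /near_modcP[r r0 HF].
  (* With [Q + 1] in place of [Q] the radius is positive even for [Q = 0], and
     [Q * modc (z - p) < 1] holds inside it. *)
  apply/near_modcP; exists (Num.min r (Q + 1)^-1).
    by rewrite lt_min r0 invr_gt0 ltr_wpDl.
  move=> z; rewrite lt_min => /andP[zr zQ].
  have [fz HFz] := HF _ zr.
  have fle n : modc (f z) <= M * (Q * modc (z - p)) ^+ n.
    have -> : f z = (z - p) ^+ n * F n z.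
      rewrite -fz; elim: n => [|n ->]; first by rewrite expr0 mul1r.
      by rewrite (HFz n).1 F0 add0r exprSr mulrA.
    rewrite modcM modcX exprMn mulrA mulrC ler_wpM2r ?exprn_ge0 ?modc_ge0//.
    exact: (HFz n).2.
  have q1 : Q * modc (z - p) < 1.
    move: zQ; rewrite -[_^-1]mul1r ltr_pdivlMr ?ltr_wpDl// mulrDr mulr1.
    have := modc_ge0 (z - p); nra.
  apply/eqP; rewrite -modc_eq0; apply/eqP/le_anti; rewrite modc_ge0 andbT.
  have cM : (M * (Q * modc (z - p)) ^+ n) @[n --> \oo] --> (0 : R).
    by apply: cvg_geometric; rewrite ger0_norm// mulr_ge0 ?modc_ge0.
  rewrite -(cvg_lim _ cM)//; apply: limr_ge; first by apply/cvg_ex; exists 0.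
  exact: nearW.
right; have [m Fm mmin] := ex_minnP (ex_intro (fun n => F n p != 0) N FN).
have F0 k : (k < m)%N -> F k p = 0.
  by move=> km; apply/eqP; apply: contraTT km => /mmin; rewrite -leqNgt.
exists m, (F m); split=> //; last exact: FE.
exists (fun n => F (m + n)%N), (M * Q ^+ m), Q; split=> //.
apply: filterS HF => z [_ HFz]; split; first by rewrite addn0.
by move=> n; rewrite addnS -mulrA -exprD; apply: HFz.
Qed.

End Analytic.

(** * Functions of bounded type on a half-plane *)

Section BoundedType.
Context {R : realType}.
Local Notation C := R[i].
Implicit Types (z w p : C) (f g n d : C -> C) (D : set C).

Lemma derivable_mul f g p : derivable f p 1 -> derivable g p 1 ->
  derivable (fun z => f z * g z) p 1.
Proof. by move=> df dg; exact: (@derivableM _ _ f g p 1 df dg). Qed.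

Lemma derivable_div f g p : derivable f p 1 -> derivable g p 1 -> g p != 0 ->
  derivable (fun z => f z / g z) p 1.
Proof. by move=> df dg g0; apply: derivable_mul df _; exact: (derivableV g0 dg). Qed.

Lemma derivable_exp f p k : derivable f p 1 -> derivable (fun z => f z ^+ k) p 1.
Proof.
move=> df; elim: k => [|k IH]; first exact: derivable_cst.
by rewrite (_ : (fun z => f z ^+ k.+1) = (fun z => f z * f z ^+ k));
  [exact: derivable_mul|apply/funext => z; rewrite exprS].
Qed.

Lemma bounded_modcP f D :
  [bounded f z | z in D] <-> exists M : R, forall z, D z -> modc (f z) <= M.
Proof.
split=> [/pinfty_ex_gt0[M M0 HM]|[M HM]].
  exists (complex.Re M) => z /HM /=; rewrite -modcE lecE => /andP[_].
  by rewrite /=.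
exists M%:C%C; split; first by rewrite complex_real.
move=> x Mx z Dz /=; rewrite -modcE; apply: le_trans (ltW Mx).
by rewrite lecR; apply: HM.
Qed.

Lemma bounded_holomorphic_cst D (c : C) : bounded_holomorphic D (fun=> c).
Proof.
split; first by move=> z _; exact: derivable_cst.
by apply/bounded_modcP; exists (modc c).
Qed.

Lemma bounded_holomorphicD D f g : bounded_holomorphic D f ->
  bounded_holomorphic D g -> bounded_holomorphic D (fun z => f z + g z).
Proof.
move=> [df /bounded_modcP[M HM]] [dg /bounded_modcP[M' HM']]; split.
  by move=> z Dz; apply: derivableD; [exact: df|exact: dg].
apply/bounded_modcP; exists (M + M') => z Dz.
by apply: le_trans (modcD _ _) _; rewrite lerD ?HM ?HM'.
Qed.

Lemma bounded_holomorphicM D f g : bounded_holomorphic D f ->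
  bounded_holomorphic D g -> bounded_holomorphic D (fun z => f z * g z).
Proof.
move=> [df /bounded_modcP[M HM]] [dg /bounded_modcP[M' HM']]; split.
  by move=> z Dz; apply: (@derivableM _ _ f g); [exact: df|exact: dg].
apply/bounded_modcP; exists (M * M') => z Dz.
by rewrite modcM ler_pM ?modc_ge0 ?HM ?HM'.
Qed.

(** Denominators without zeros make the class closed under sums and products with no case
    distinction. Zeros of a denominator enter only at the end, through the determinant. *)
Definition quotient_of_bounded D f := exists f1 f2 : C -> C,
  [/\ bounded_holomorphic D f1, bounded_holomorphic D f2,
      forall z, D z -> f2 z != 0 & forall z, D z -> f z = f1 z / f2 z].

Definition bt_analytic D f :=
  (forall p, D p -> analytic_at f p) /\ quotient_of_bounded D f.

Lemma bt_analytic_cst D c : bt_analytic D (fun=> c).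
Proof.
split; first by move=> p _; exact: analytic_cst.
exists (fun=> c), (fun=> 1); split=> [||z _|z _].
- exact: bounded_holomorphic_cst.
- exact: bounded_holomorphic_cst.
- exact: oner_neq0.
- by rewrite divr1.
Qed.

Lemma bt_analyticD D f g :
  bt_analytic D f -> bt_analytic D g -> bt_analytic D (fun z => f z + g z).
Proof.
move=> [af [f1 [f2 [bf1 bf2 f20 fE]]]] [ag [g1 [g2 [bg1 bg2 g20 gE]]]]; split.
  by move=> p Dp; apply: analyticD; [exact: af|exact: ag].
exists (fun z => f1 z * g2 z + g1 z * f2 z), (fun z => f2 z * g2 z); split.
- by apply: bounded_holomorphicD; apply: bounded_holomorphicM.
- exact: bounded_holomorphicM.
- by move=> z Dz; rewrite mulf_neq0 ?f20 ?g20.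
- by move=> z Dz; rewrite fE// gE// addf_div ?f20 ?g20.
Qed.

Lemma bt_analyticM D f g :
  bt_analytic D f -> bt_analytic D g -> bt_analytic D (fun z => f z * g z).
Proof.
move=> [af [f1 [f2 [bf1 bf2 f20 fE]]]] [ag [g1 [g2 [bg1 bg2 g20 gE]]]]; split.
  by move=> p Dp; apply: analyticM; [exact: af|exact: ag].
exists (fun z => f1 z * g1 z), (fun z => f2 z * g2 z); split.
- exact: bounded_holomorphicM.
- exact: bounded_holomorphicM.
- by move=> z Dz; rewrite mulf_neq0 ?f20 ?g20.
- by move=> z Dz; rewrite fE// gE// mulf_div.
Qed.

Lemma eq_bt_analytic D f g : f =1 g -> bt_analytic D f -> bt_analytic D g.
Proof. by move=> /funext ->. Qed.

Lemma bt_analyticB D f g :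
  bt_analytic D f -> bt_analytic D g -> bt_analytic D (fun z => f z - g z).
Proof.
move=> hf hg; apply: eq_bt_analytic (_ : bt_analytic D (fun z => f z + -1 * g z)).
  by move=> z; rewrite mulN1r.
by apply: bt_analyticD => //; apply: bt_analyticM => //; exact: bt_analytic_cst.
Qed.

(* [f / (1 + f)] and [1 / (1 + f)] are bounded by 1 where [0 <= Re f]. *)
Lemma bt_analytic_Re_ge0 D f : (forall p, D p -> analytic_at f p) ->
  (forall z, D z -> 0 <= complex.Re (f z)) -> bt_analytic D f.
Proof.
move=> af f0; split=> //.
have nz z : D z -> 1 + f z != 0.
  move=> /f0 fz; apply/eqP => /(congr1 (@complex.Re R)).
  by rewrite raddfD/= => h; have := ltr01 (R := R); rewrite ltNge -h lerDl fz.
have der z : D z -> derivable (fun w => (1 + f w)^-1) z 1.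
  move=> Dz; apply: derivableV; first exact: nz.
  by apply: derivableD; [exact: derivable_cst|exact/analytic_derivable/af].
have sq z : D z -> modc (1 + f z) ^+ 2 = 1 + 2 * complex.Re (f z) + modc (f z) ^+ 2.
  by move=> Dz; rewrite !modc_sqr; case: (f z) => a b /=; ring.
have le1 z : D z -> 1 <= modc (1 + f z).
  move=> Dz; have := sq z Dz; have := f0 z Dz; have := modc_ge0 (1 + f z).
  by have := modc_ge0 (f z); nra.
have lef z : D z -> modc (f z) <= modc (1 + f z).
  move=> Dz; have := sq z Dz; have := f0 z Dz; have := modc_ge0 (1 + f z).
  by have := modc_ge0 (f z); nra.
exists (fun z => f z * (1 + f z)^-1), (fun z => (1 + f z)^-1); split.
- split=> [z Dz|].
    by apply: (@derivableM _ _ f); [exact/analytic_derivable/af|exact: der].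
  apply/bounded_modcP; exists 1 => z Dz; rewrite modcM modcV.
  by rewrite ler_pdivrMr ?mul1r ?lef// (lt_le_trans _ (le1 z Dz)).
- split=> //; apply/bounded_modcP; exists 1 => z Dz; rewrite modcV.
  by rewrite invf_le1 ?le1// (lt_le_trans _ (le1 z Dz)).
- by move=> z Dz; rewrite invr_neq0// nz.
- by move=> z Dz; rewrite mulfK// invr_neq0// nz.
Qed.

(* For [e = 'i] and [e = - 'i] this is the open half-plane containing [- e]. *)
Definition half_plane (e : C) : set C := [set z | complex.Re (e * z^*) < 0].

(** The coordinate is unbounded, but multiplication by [- e^-1] rotates the half-plane onto the
    right half-plane, where real parts are positive. *)
Lemma bt_analytic_id e : modc e = 1 -> bt_analytic (half_plane e) id.
Proof.
move=> e1; have e0 : e != 0 by rewrite -modc_eq0 e1 oner_eq0.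
suff H : bt_analytic (half_plane e) (fun z => - e^-1 * z).
  apply: eq_bt_analytic (bt_analyticM (bt_analytic_cst _ (- e)) H).
  by move=> z /=; field.
apply: bt_analytic_Re_ge0 => [p _|z].
  exact/analyticM/analytic_id/analytic_cst.
rewrite /half_plane /= => h; rewrite mulNr raddfN/= oppr_ge0.
have -> : e^-1 = e^*.
  by apply: (mulfI e0); rewrite mulfV// -normCK -modcE e1 expr1n.
by move: h; case: e e1 e0 => a b _ _; case: z => x y /= h; lra.
Qed.

Lemma half_plane_open e : modc e = 1 -> open (half_plane e).
Proof.
move=> e1; rewrite openE => p Dp; apply/near_modcP.
exists (- complex.Re (e * p^*)); first by rewrite oppr_gt0.
move=> z zp; have : `|complex.Re (e * (z - p)^*)| <= modc (z - p).
  by apply: le_trans (Re_le_modc _) _; rewrite modcM e1 mul1r modcJ.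
rewrite rmorphB mulrBr raddfB /= ler_norml /half_plane /= => /andP[_ h].
by move: zp h; lra.
Qed.

Lemma eq_bt_analytic_in D f g : open D -> (forall z, D z -> f z = g z) ->
  bt_analytic D f -> bt_analytic D g.
Proof.
move=> Do fg [af [f1 [f2 [b1 b2 f20 fE]]]]; split.
  move=> p Dp; apply: analytic_near (af p Dp).
  by apply: filterS fg _; apply: open_nbhs_nbhs.
by exists f1, f2; split=> // z Dz; rewrite -fg// fE.
Qed.

(** * Isolated zeros, the identity theorem and poles *)

Lemma nonzero_near n p : {for p, continuous n} -> n p != 0 ->
  \forall z \near p, n z != 0.
Proof.
move=> /continuous_modcP nc n0; have := nc (modc (n p)).
rewrite modc_gt0 => /(_ n0); apply: filterS => z.
by apply: contraTneq => ->; rewrite sub0r modcN ltxx.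
Qed.

(** Suppose [f] vanishes near [p]. On the segment from [p] to [w], the points near which [f]
    vanishes form an open set, and a closed one because an isolated zero is not a limit of such
    points. Connectedness then carries the vanishing to [w]. *)
Lemma identity_theorem e f w : (forall p, half_plane e p -> analytic_at f p) ->
  half_plane e w -> f w != 0 ->
  forall p, half_plane e p -> exists N g, [/\ analytic_at g p, g p != 0 &
    \forall z \near p, f z = (z - p) ^+ N * g z].
Proof.
move=> af Dw fw p Dp; have [f0|//] := analytic_zero (af p Dp); exfalso.
pose O := [set z : C | \forall x \near z, f x = 0].
have [c [cc c0 c1 cD]] : exists c : R -> C, [/\ continuous c, c 0 = p, c 1 = w &
    forall t, `[0, 1]%classic t -> half_plane e (c t)].
  exists (fun t => p + t%:C%C * (w - p)); split.
  - move=> t; apply: cvgD; first exact: cvg_cst.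
    apply: cvgM; last exact: cvg_cst.
    move=> P /near_modcP[r r0 rP]; apply/nbhs_normP; exists r => //= s.
    by rewrite /= distrC => ts; apply: rP; rewrite -rmorphB modc_real.
  - by rewrite mul0r addr0.
  - by rewrite mul1r addrC subrK.
  - move=> t; rewrite /= in_itv/= => /andP[t0 t1]; move: Dp Dw; rewrite /half_plane /=.
    case: e p w {af fw f0 O} => [a b] [x y] [u v] /= h1 h2.
    have -> : a * (x + (t * (u - x) - 0 * (v - y))) -
        b * - (y + (t * (v - y) + 0 * (u - x))) =
        (1 - t) * (a * x - b * - y) + t * (a * u - b * - v) by ring.
    (* One of the weights [t] and [1 - t] is at least 1/2, which keeps the convex combination
       strictly negative. *)
    by have [t2|t2] := lerP t 2^-1; nra.
have Oo : open O.
  by rewrite openE => z; rewrite /O /interior /= => /near_join.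
have Oc : open (c @^-1` O).
  rewrite openE => t Ot; have OO : nbhs (c t) O by exact: open_nbhs_nbhs.
  by have := cc t O OO; rewrite nbhs_simpl.
have dich t : `[0, 1]%classic t -> closure (c @^-1` O) t -> O (c t).
  move=> /cD /af /analytic_zero[//|[N [g [ga g0 fE]]]] ct; exfalso.
  have h : \forall z \near c t, z != c t -> f z != 0.
    have gn := nonzero_near (analytic_continuous ga) g0.
    apply: filterS2 fE gn => z -> gz zc.
    by rewrite mulf_neq0// expf_neq0// subr_eq0.
  pose U : set C := [set y : C | \forall x \near y, x != c t -> f x != 0].
  have hU : nbhs (c t) U by exact: near_join h.
  (* Near such a point [c s], [f] vanishes everywhere and yet only [c t] can be a zero. A whole disc
     would then reduce to the point [c t]. *)
  have := cc t U hU; rewrite nbhs_simpl /= => /ct[s [Os hs]].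
  have /near_modcP[r r0 H] : \forall x \near c s, x = c t.
    apply: filterS2 Os hs => x fx; apply: contraPP => /eqP xc.
    by move=> /(_ xc); rewrite fx eqxx.
  have := H (c s); rewrite subrr modc0 => /(_ r0) E1.
  have := H (c s + (r / 2)%:C%C); rewrite addrC addKr modc_real.
  rewrite ger0_norm ?divr_ge0 ?ltW// ltr_pdivrMr ?ltr_pMr ?ltr1n// => /(_ isT).
  rewrite E1 => /eqP; rewrite -subr_eq0 addrAC subrr add0r -modc_eq0 modc_real normr_eq0.
  by rewrite gt_eqF// divr_gt0.
have : [set t | `[0, 1]%classic t /\ O (c t)] = `[0, 1]%classic.
  apply: (@segment_connected R 0 1).
  - exists 0; split; first by rewrite /= in_itv/= lexx ler01.
    by rewrite c0.
  - by exists (c @^-1` O).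
  - exists (closure (c @^-1` O)); first exact: closed_closure.
    have sc := @subset_closure _ (c @^-1` O).
    rewrite eqEsubset; split=> t [t01 ht]; split; [exact: t01|exact: sc|exact: t01|].
    by apply: dich.
move/seteqP => [_ /(_ 1)] /=; rewrite in_itv/= ler01 lexx => /(_ isT) [_].
rewrite c1 => /nbhs_singleton fw0.
by rewrite fw0 eqxx in fw.
Qed.

(** After cancelling the zero of [d], the numerator is [n / g]. Analyticity of [g] is given at [p]
    alone; at nearby points derivability comes from [g = d / (z - p) ^+ N]. *)
Lemma quotient_pole f n d p :
  (\forall z \near p, derivable n z 1) -> (\forall z \near p, derivable d z 1) ->
  (exists N g, [/\ analytic_at g p, g p != 0 &
    \forall z \near p, d z = (z - p) ^+ N * g z]) ->
  (\forall z \near p^', f z = n z / d z) -> pole_or_removable f p.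
Proof.
move=> dn dd [N [g [ag gp dE]]] fE.
exists N, (fun z => n z / g z); split; last first.
  move: fE; rewrite !near_withinE => fE.
  apply: filterS2 fE dE => z fEz dEz /fEz ->; rewrite dEz invfM; ring.
have gn := nonzero_near (analytic_continuous ag) gp.
have dEE := near_join dE.
apply: filterS3 (filterI dn dd) gn dEE => z [nz dz] gz dEz.
apply: derivable_div nz _ gz.
have [->|zp] := eqVneq z p; first exact: analytic_derivable.
have zp' : z - p != 0 by rewrite subr_eq0.
have dp : derivable (fun x : C => x - p) z 1.
  by apply: derivableB; [exact: derivable_id|exact: derivable_cst].
have dX : derivable (fun x : C => (x - p) ^+ N) z 1 := derivable_exp dp.
have hz : \forall x \near z, x - p != 0.
  exact: nonzero_near (derivable_continuous_at dp) zp'.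
have : \forall x \near z, d x / (x - p) ^+ N = g x.
  apply: filterS2 hz dEz => x xp ->.
  by rewrite mulrAC divff ?mul1r// expf_neq0.
move/near_eq_derivable; apply.
by apply: derivable_div => //; rewrite expf_neq0.
Qed.

End BoundedType.

(** * Hilbert spaces *)

Section InnerProduct.
Context {R : realType} {K : lmodType R[i]}.
Local Notation C := R[i].
Implicit Types (x y z : K) (a b c : C) (V : K -> K) (M : set K).

(** These two identities are shared by the indefinite form and by the Hilbert product built from it,
    so that the same algebraic lemmas serve both. *)
Record hermitian_form (ip : K -> K -> C) : Prop := HermitianForm {
  ip_linl : forall a x y z, ip (a *: x + y) z = a * ip x z + ip y z;
  ip_herm : forall x y, ip x y = (ip y x)^* }.

Context (ip : K -> K -> C).
Hypothesis hip : hermitian_form ip.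

Lemma ipDl x y z : ip (x + y) z = ip x z + ip y z.
Proof. by rewrite -[x]scale1r (ip_linl hip) scale1r mul1r. Qed.

Lemma ip0l z : ip 0 z = 0.
Proof. by apply: (addrI (ip 0 z)); rewrite -ipDl !addr0. Qed.

Lemma ipZl a x z : ip (a *: x) z = a * ip x z.
Proof. by rewrite -[a *: x]addr0 (ip_linl hip) ip0l addr0. Qed.

Lemma ipNl x z : ip (- x) z = - ip x z.
Proof. by rewrite -scaleN1r ipZl mulN1r. Qed.

Lemma ipBl x y z : ip (x - y) z = ip x z - ip y z.
Proof. by rewrite ipDl ipNl. Qed.

Lemma ipDr x y z : ip x (y + z) = ip x y + ip x z.
Proof. by rewrite (ip_herm hip) ipDl rmorphD /= -!(ip_herm hip). Qed.

Lemma ipZr a x z : ip x (a *: z) = a^* * ip x z.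
Proof. by rewrite (ip_herm hip) ipZl rmorphM /= -(ip_herm hip). Qed.

Lemma ip0r z : ip z 0 = 0.
Proof. by rewrite (ip_herm hip) ip0l rmorph0. Qed.

Lemma ipNr x z : ip x (- z) = - ip x z.
Proof. by rewrite -scaleN1r ipZr rmorphN1 mulN1r. Qed.

Lemma ipBr x y z : ip x (y - z) = ip x y - ip x z.
Proof. by rewrite ipDr ipNr. Qed.

Hypothesis complete_ip : hilbert_on ip setT.
Local Notation N := (form_norm ip).

Lemma ip_ge0 x : 0 <= ip x x.
Proof.
have [->|x0] := eqVneq x 0; first by rewrite ip0l.
by case: complete_ip => _ pos _; rewrite ltW// pos.
Qed.

Lemma ip_eq0 x : (ip x x == 0) = (x == 0).
Proof.
have [->|x0] := eqVneq x 0; first by rewrite ip0l eqxx.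
by case: complete_ip => _ pos _; rewrite gt_eqF// pos.
Qed.

Lemma ip_sqr x : ip x x = (N x ^+ 2)%:C%C.
Proof.
have := ip_ge0 x; rewrite lecE /= => /andP[/eqP im re].
by rewrite sqr_sqrtr//; case: (ip x x) im re => u v /= -> _.
Qed.

Lemma form_norm_ge0 x : 0 <= N x.
Proof. exact: sqrtr_ge0. Qed.

Lemma form_norm_eq0 x : (N x == 0) = (x == 0).
Proof. by rewrite -ip_eq0 ip_sqr -(rmorph0 (real_complex R)) (inj_eq (@complexI R)) sqrf_eq0. Qed.

Lemma form_norm0 : N 0 = 0.
Proof. by apply/eqP; rewrite form_norm_eq0. Qed.

Lemma form_normZ a x : N (a *: x) = modc a * N x.
Proof.
apply: (@pexpIrn _ 2); rewrite ?nnegrE ?mulr_ge0 ?form_norm_ge0 ?modc_ge0//.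
apply: complexI; rewrite -ip_sqr ipZl ipZr mulrA -normCK -modcE ip_sqr.
by rewrite exprMn [RHS]rmorphM /= [(modc a ^+ 2)%:C%C]rmorphXn.
Qed.

Lemma form_normN x : N (- x) = N x.
Proof. by rewrite -scaleN1r form_normZ modcN modc1 mul1r. Qed.

Lemma form_normBC x y : N (x - y) = N (y - x).
Proof. by rewrite -form_normN opprB. Qed.

Lemma form_norm_sqrD x y :
  N (x + y) ^+ 2 = N x ^+ 2 + N y ^+ 2 + 2 * complex.Re (ip x y).
Proof.
apply: complexI; rewrite -ip_sqr ipDl !ipDr !ip_sqr (ip_herm hip y x).
rewrite !rmorphD rmorphM/=.
by case: (ip x y) => u v; apply/eqP; rewrite eq_complex/=; apply/andP; split; apply/eqP; ring.
Qed.

Lemma ip_CauchySchwarz x y : modc (ip x y) <= N x * N y.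
Proof.
have [->|y0] := eqVneq y 0; first by rewrite ip0r modc0 mulr_ge0 ?form_norm_ge0.
have Ny : 0 < N y by rewrite lt0r form_norm_eq0 y0 form_norm_ge0.
(* [c *: y] is the orthogonal projection of [x] onto the line of [y]; the inequality is the
   nonnegativity of the squared norm of the remainder. *)
pose c := (ip x y) / (N y ^+ 2)%:C%C.
have := exprn_ge0 2 (form_norm_ge0 (x - c *: y)).
rewrite form_norm_sqrD form_normN ipNr ipZr form_normZ exprMn.
have -> : c^* * ip x y = (modc (ip x y) ^+ 2 / N y ^+ 2)%:C%C.
  rewrite /c rmorphM fmorphV /= conj_real mulrAC [_^* * _]mulrC -normCK -modcE.
  by rewrite [RHS]rmorphM fmorphV /= [(modc _ ^+ 2)%:C%C]rmorphXn.
have -> : modc c = modc (ip x y) / N y ^+ 2.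
  by rewrite /c modcM modcV modc_real ger0_norm// exprn_ge0// ltW.
rewrite raddfN /=.
have -> : N x ^+ 2 + (modc (ip x y) / N y ^+ 2) ^+ 2 * N y ^+ 2 +
  2 * - (modc (ip x y) ^+ 2 / N y ^+ 2) = N x ^+ 2 - modc (ip x y) ^+ 2 / N y ^+ 2.
  by field; rewrite gt_eqF.
rewrite subr_ge0 ler_pdivrMr ?exprn_gt0// -exprMn.
by rewrite ler_sqr ?nnegrE ?mulr_ge0 ?form_norm_ge0 ?modc_ge0.
Qed.

Lemma form_normD x y : N (x + y) <= N x + N y.
Proof.
rewrite -(@ler_sqr _ (N (x + y))) ?nnegrE ?addr_ge0 ?form_norm_ge0//.
rewrite form_norm_sqrD.
have := ip_CauchySchwarz x y; have := Re_le_modc (ip x y).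
have := ler_norm (complex.Re (ip x y)); nra.
Qed.

Lemma form_normB x y : N (x - y) <= N x + N y.
Proof. by rewrite -(form_normN y) form_normD. Qed.

Lemma form_norm_cvgP (u : nat -> K) l : N (u n - l) @[n --> \oo] --> (0 : R) <->
  forall e : R, 0 < e -> exists n0 : nat, forall n, (n0 <= n)%N -> N (u n - l) < e.
Proof.
split=> [/cvgr0Pnorm_lt H e e0|H].
  have [n0 _ Hn] := H e e0; exists n0 => n /Hn /=.
  by rewrite ger0_norm ?form_norm_ge0.
apply/cvgr0Pnorm_lt => e e0; have [n0 Hn] := H e e0.
by exists n0 => // n /= /Hn; rewrite ger0_norm ?form_norm_ge0.
Qed.

Lemma complete_cauchy (u : nat -> K) :
  (forall e : R, 0 < e -> exists n0 : nat, forall m n : nat,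
     (n0 <= m)%N -> (n0 <= n)%N -> N (u m - u n) < e) ->
  exists l, forall e : R, 0 < e ->
    exists n0 : nat, forall n, (n0 <= n)%N -> N (u n - l) < e.
Proof.
move=> uc; case: complete_ip => _ _ /(_ u (fun=> I) uc)[l _ ul].
by exists l; apply/form_norm_cvgP.
Qed.

Definition linear_map V := forall a x y, V (a *: x + y) = a *: V x + V y.

(** The iteration [u (n + 1) = y - V (u n)] has steps shrinking by the factor [k]; its limit solves
    the equation because [V] is continuous. *)
Lemma neumann V (k : R) : linear_map V -> 0 <= k < 1 ->
  (forall x, N (V x) <= k * N x) -> forall y, exists x, x + V x = y.
Proof.
move=> Vl /andP[k0 k1] Vk y.
have VB x z : V (x - z) = V x - V z.
  by rewrite addrC -scaleN1r Vl scaleN1r addrC.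
pose u := fix u n := if n is n'.+1 then y - V (u n') else 0.
have uE n : u n.+1 = y - V (u n) by [].
have du n : N (u n.+1 - u n) <= k ^+ n * N y.
  elim: n => [|n IH].
    have V0 : V 0 = 0 by have := VB 0 0; rewrite !subrr.
    by rewrite /= V0 !subr0 expr0 mul1r.
  have -> : u n.+2 - u n.+1 = - V (u n.+1 - u n).
    rewrite VB opprB (uE n.+1).
    by rewrite addrC subrKA [RHS]opprB.
  rewrite form_normN; apply: le_trans (Vk _) _.
  by rewrite exprS -mulrA ler_wpM2l.
have k1' : 0 < 1 - k by rewrite subr_gt0.
(* The factor [1 - k ^+ m] is that of the exact geometric sum, so the induction step on [m] closes
   with equality. *)
have dunm n m : N (u (n + m)%N - u n) <= k ^+ n / (1 - k) * N y * (1 - k ^+ m).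
  elim: m => [|m IH]; first by rewrite addn0 subrr form_norm0 expr0 subrr mulr0.
  rewrite addnS -(subrK (u (n + m)%N) (u _.+1)) -addrA.
  apply: le_trans (form_normD _ _) _.
  apply: le_trans (lerD (du _) IH) _; rewrite le_eqVlt; apply/orP; left.
  by apply/eqP; rewrite exprD exprS; field; rewrite gt_eqF.
pose B := N y / (1 - k).
have B0 : 0 <= B by rewrite divr_ge0 ?form_norm_ge0// ltW.
have dunm' n m : (n <= m)%N -> N (u m - u n) <= B * k ^+ n.
  move=> /subnKC <-; apply: le_trans (dunm _ _) _.
  have -> : k ^+ n / (1 - k) * N y * (1 - k ^+ (m - n)) =
    (B * k ^+ n) * (1 - k ^+ (m - n)) by rewrite /B; ring.
  apply: ler_piMr; first by apply: mulr_ge0 => //; apply: exprn_ge0.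
  by rewrite gerBl; apply: exprn_ge0.
have Bk e : 0 < e -> exists n0 : nat, forall n, (n0 <= n)%N -> B * k ^+ n < e.
  move=> e0; have : (B * k ^+ n) @[n --> \oo] --> (0 : R).
    by apply: cvg_geometric; rewrite ger0_norm.
  move=> /cvgr0Pnorm_lt /(_ e e0)[n0 _ Hn]; exists n0 => n /Hn /=.
  by apply: le_lt_trans; rewrite ler_norm.
have [|l ul] := @complete_cauchy u.
  move=> e e0; have [n0 Hn] := Bk _ (divr_gt0 e0 (ltr0n _ 2)).
  exists n0 => m n m0 n0'; rewrite -(subrK (u n0) (u m)) -addrA.
  apply: le_lt_trans (form_normD _ _) _; rewrite [N (u n0 - _)]form_normBC.
  have := dunm' _ _ m0; have := dunm' _ _ n0'; have := Hn _ (leqnn _); lra.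
exists l; apply/eqP; rewrite -subr_eq0 -form_norm_eq0; apply/eqP/le_anti.
rewrite form_norm_ge0 andbT; apply/ler_addgt0Pr => e e0; rewrite add0r.
have [n0 Hn] := ul _ (divr_gt0 e0 (ltr0n _ 2)).
have -> : l + V l - y = (l - u n0.+1) + V (l - u n0).
  by rewrite VB uE opprB [RHS]addrACA [V (u n0) - y - _]addrAC subrr add0r.
apply: le_trans (form_normD _ _) _.
have := Hn _ (leqnn _); have := Hn _ (leqnSn _); have := Vk (l - u n0).
rewrite !(form_normBC l); have := form_norm_ge0 (u n0 - l); nra.
Qed.

Definition subspace_closed M := forall u x, (forall n : nat, M (u n)) ->
  (forall e : R, 0 < e -> exists n0 : nat, forall n, (n0 <= n)%N -> N (u n - x) < e) ->
  M x.

(** A minimizing sequence for the distance to [M] is Cauchy; orthogonality is the vanishing of the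
    first variation at its limit. *)
Lemma projection M x : is_subspace M -> subspace_closed M ->
  exists2 m, M m & forall k, M k -> ip (x - m) k = 0.
Proof.
move=> [M0 Ml] Mc.
have MD y z : M y -> M z -> M (y + z) by move=> My Mz; rewrite -[y]scale1r; exact: Ml.
have MZ a y : M y -> M (a *: y) by move=> My; rewrite -[_ *: _]addr0; exact: Ml.
pose E := [set N (x - m) ^+ 2 | m in M].
have Ei : has_inf E.
  split; first by exists (N (x - 0) ^+ 2), 0.
  by exists 0 => _ [m _ <-]; rewrite exprn_ge0// form_norm_ge0.
have dle m : M m -> inf E <= N (x - m) ^+ 2.
  by move=> Mm; apply: ge_inf; [exact: Ei.2|exists m].
have h n : exists m, M m /\ N (x - m) ^+ 2 < inf E + n.+1%:R^-1.
  have [|_ [m Mm <-] hm] := @inf_adherent _ E n.+1%:R^-1 _ Ei; first by rewrite invr_gt0.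
  by exists m.
have [u uP] := choice h.
(* Parallelogram law: the midpoint of [u m] and [u n] lies in [M], so its squared distance to [x] is
   not below the infimum. *)
have par m n : N (u m - u n) ^+ 2 <= 2 / m.+1%:R + 2 / n.+1%:R.
  have Mh : M (2^-1 *: (u m + u n)) by apply/MZ/MD; apply: (uP _).1.
  have := dle _ Mh.
  have -> : x - 2^-1 *: (u m + u n) = 2^-1 *: ((x - u m) + (x - u n)).
    rewrite addrACA -opprD -[x + x]mulr2n -[x *+ 2]scaler_nat scalerBr scalerA mulVf ?scale1r//.
  have -> : u m - u n = (x - u n) - (x - u m) by rewrite opprB [RHS]addrC subrKA.
  rewrite form_normZ exprMn (form_norm_sqrD (x - u n)) form_normN ipNr.
  rewrite (form_norm_sqrD (x - u m)) (ip_herm hip (x - u m)) raddfN/=.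
  rewrite modcV; have -> : modc (2 : C) = 2.
    by rewrite -(rmorph_nat (real_complex R) 2) modc_real ger0_norm.
  have := (uP m).2; have := (uP n).2.
  case: (ip (x - u n) (x - u m)) => s t /=.
  by move: (m.+1%:R^-1 : R) (n.+1%:R^-1 : R) => a b; lra.
have [|l ul] := @complete_cauchy u.
  move=> e e0.
  have [n0 _ Hn] : \forall n \near \oo, n.+1%:R^-1 < e ^+ 2 / 4.
    by apply: near_infty_natSinv_lt (PosNum _); rewrite divr_gt0 ?exprn_gt0.
  exists n0 => m n m0 nn0.
  rewrite -(@ltr_sqr _ _ e) ?nnegrE ?form_norm_ge0 ?ltW//.
  apply: le_lt_trans (par _ _) _.
  have /= := Hn _ m0; have /= := Hn _ nn0; move: (m.+1%:R^-1 : R) (n.+1%:R^-1 : R) => a b; lra.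
have Ml' : M l by apply: Mc ul => n; exact: (uP n).1.
have hl : N (x - l) <= Num.sqrt (inf E).
  apply/ler_addgt0Pr => e e0.
  have i0 : 0 <= inf E.
    by apply: lb_le_inf => [|_ [m _ <-]]; [exact: Ei.1|rewrite exprn_ge0 ?form_norm_ge0].
  have [n0 Hn] := ul _ (divr_gt0 e0 (ltr0n _ 2)).
  have [n1 _ Hn1] : \forall n \near \oo, n.+1%:R^-1 < (e / 2) ^+ 2.
    by apply: near_infty_natSinv_lt (PosNum _); rewrite exprn_gt0 ?divr_gt0.
  have := Hn _ (leq_maxl n0 n1); have /= := Hn1 _ (leq_maxr n0 n1).
  set n := maxn n0 n1 => h1 h2.
  have h3 : N (x - u n) <= Num.sqrt (inf E) + e / 2.
    have := sqr_sqrtr i0; move: (Num.sqrt (inf E)) (sqrtr_ge0 (inf E)) => s s0 sE.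
    have := (uP n).2; move: h1; move: (n.+1%:R^-1 : R) (form_norm_ge0 (x - u n)) => a.
    move: (N _) => t; nra.
  rewrite -(subrK (u n) x) -addrA; apply: le_trans (form_normD _ _) _.
  lra.
exists l => // k Mk; apply/eqP; rewrite -modc_eq0; apply/eqP.
have [->|k0] := eqVneq k 0; first by rewrite ip0r modc0.
have Nk : 0 < N k by rewrite lt0r form_norm_eq0 k0 form_norm_ge0.
(* Moving [l] by [c *: k] lowers the squared distance by [modc (ip (x - l) k) ^+ 2 / N k ^+ 2],
   which minimality forces to be zero. *)
pose c := ip (x - l) k / (N k ^+ 2)%:C%C.
have Mlc : M (l + c *: k) by apply: MD => //; apply: MZ.
have := dle _ Mlc.
have i0 : 0 <= inf E.
  by apply: lb_le_inf => [|_ [m _ <-]]; [exact: Ei.1|rewrite exprn_ge0 ?form_norm_ge0].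
have hl2 : N (x - l) ^+ 2 <= inf E.
  by rewrite -[leRHS]sqr_sqrtr// ler_sqr ?nnegrE ?form_norm_ge0 ?sqrtr_ge0.
rewrite opprD addrA form_norm_sqrD form_normN ipNr ipZr form_normZ exprMn.
have -> : c^* * ip (x - l) k = (modc (ip (x - l) k) ^+ 2 / N k ^+ 2)%:C%C.
  rewrite /c rmorphM fmorphV /= conj_real mulrAC [_^* * _]mulrC -normCK -modcE.
  by rewrite [RHS]rmorphM fmorphV /= [(modc _ ^+ 2)%:C%C]rmorphXn.
have -> : modc c = modc (ip (x - l) k) / N k ^+ 2.
  by rewrite /c modcM modcV modc_real ger0_norm// exprn_ge0// ltW.
rewrite raddfN /= => hh.
set t := modc _ in hh *.
have : t ^+ 2 / N k ^+ 2 <= 0.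
  have E1 : (t / N k ^+ 2) ^+ 2 * N k ^+ 2 = t ^+ 2 / N k ^+ 2.
    by field; rewrite gt_eqF.
  by move: hh; rewrite E1; lra.
rewrite pmulr_lle0 ?invr_gt0 ?exprn_gt0// => t0.
by apply/eqP; rewrite -sqrf_eq0; apply/eqP/le_anti; rewrite t0 sqr_ge0.
Qed.

End InnerProduct.

(** * Resolvents of relations *)

Section Resolvent.
Context {R : realType} {K : lmodType R[i]}.
Local Notation C := R[i].
Implicit Types (x y f g : K) (z p : C) (W : set (K * K)) (N : K -> R).

(** Membership of [(f, x + z *: f)] in [W] says that [W - z] relates [f] to [x]. The a priori bound
    at [x = 0] contains injectivity, so no inverse map has to be named. *)
Definition bounded_resolvent N W z (Q : R) :=
  (forall x, exists f, W (f, x + z *: f)) /\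
  forall f x, W (f, x + z *: f) -> N f <= Q * N x.

Lemma subspaceD (V : lmodType C) (S : set V) u v :
  is_subspace S -> S u -> S v -> S (u + v).
Proof. by move=> [_ Sl] Su Sv; rewrite -[u]scale1r; exact: Sl. Qed.

Lemma subspaceZ (V : lmodType C) (S : set V) (a : C) u :
  is_subspace S -> S u -> S (a *: u).
Proof. by move=> [S0 Sl] Su; rewrite -[_ *: _]addr0; exact: Sl. Qed.

Lemma subspaceB (V : lmodType C) (S : set V) u v :
  is_subspace S -> S u -> S v -> S (u - v).
Proof.
by move=> sS Su Sv; apply: subspaceD => //; rewrite -scaleN1r; exact: subspaceZ.
Qed.

Context (ip : K -> K -> C).
Hypothesis hip : hermitian_form ip.
Hypothesis complete_ip : hilbert_on ip setT.
Local Notation N := (form_norm ip).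
Context (W : set (K * K)).
Hypothesis sW : is_subspace W.

Lemma bounded_resolvent_uniq z Q f g x : bounded_resolvent N W z Q ->
  W (f, x + z *: f) -> W (g, x + z *: g) -> f = g.
Proof.
move=> [_ WQ] Wf Wg; apply/eqP; rewrite -subr_eq0 -(form_norm_eq0 hip complete_ip).
apply/eqP/le_anti; rewrite form_norm_ge0 andbT.
have := WQ (f - g) 0; rewrite (form_norm0 hip complete_ip) mulr0; apply.
have := subspaceB sW Wf Wg.
by congr W; congr pair => /=; rewrite add0r scalerBr opprD addrACA subrr add0r.
Qed.

Lemma resolventP z Q x : bounded_resolvent N W z Q ->
  W (resolvent W z x, x + z *: resolvent W z x).
Proof.
move=> [ex _]; have [f Wf] := ex x.
exact: (xgetPex 0 (ex_intro (fun y => W (y, x + z *: y)) f Wf)).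
Qed.

Lemma resolvent_eq z Q f x : bounded_resolvent N W z Q ->
  W (f, x + z *: f) -> resolvent W z x = f.
Proof. by move=> br Wf; exact: bounded_resolvent_uniq br (resolventP x br) Wf. Qed.

Lemma resolvent_bound z Q x : bounded_resolvent N W z Q ->
  N (resolvent W z x) <= Q * N x.
Proof. by move=> br; apply: br.2; exact: resolventP br. Qed.

Lemma resolvent_linear z Q : bounded_resolvent N W z Q ->
  linear_map (resolvent W z).
Proof.
move=> br a x y; apply: resolvent_eq (br) _.
have := sW.2 a _ _ (resolventP x br) (resolventP y br).
congr W; congr pair => /=.
by rewrite !scalerDr addrACA !scalerA [a * z]mulrC.
Qed.

Lemma resolvent_identity z p Q Q' x : bounded_resolvent N W z Q ->
  bounded_resolvent N W p Q' ->
  resolvent W z x = resolvent W p x + (z - p) *: resolvent W z (resolvent W p x).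
Proof.
move=> bz bp; apply: resolvent_eq (bz) _.
set f := resolvent W p x; set g := resolvent W z f.
have Wf : W (f, x + p *: f) := resolventP x bp.
have Wg : W (g, f + z *: g) := resolventP f bz.
have := sW.2 (z - p) _ _ Wg Wf.
congr W; congr pair => /=; first by rewrite addrC.
rewrite !scalerDr !scalerA [z * _]mulrC addrCA; congr (x + _).
by rewrite addrAC -scalerDl subrK.
Qed.

(** With [T] the resolvent at [p], [W - z] is [1 - (z - p) T] after [W - p]. The perturbation has
    norm at most 1/2, whence the factor 2, and one bound serves a whole disc. *)
Lemma bounded_resolvent_open p Q z : bounded_resolvent N W p Q -> 0 <= Q ->
  2 * Q * modc (z - p) <= 1 -> bounded_resolvent N W z (2 * Q).
Proof.
move=> bp Q0 zp; split=> [x|f x Wf].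
  pose V (y : K) := - (z - p) *: resolvent W p y.
  have Vl : linear_map V.
    move=> a u v; rewrite /V (resolvent_linear bp) scalerDr !scalerA.
    by rewrite [a * _]mulrC.
  have [||h hE] := neumann hip complete_ip (k := 2^-1) Vl _ _ x.
  - by rewrite invr_ge0 ler0n invf_lt1 ?ltr1n ?ltr0n.
  - move=> y; rewrite form_normZ// modcN.
    have := resolvent_bound y bp; have := form_norm_ge0 ip y.
    have := form_norm_ge0 ip (resolvent W p y); have := modc_ge0 (z - p).
    move: (N (resolvent W p y)) (N y) (modc _) zp => t n m zp m0 t0 n0 tn.
    have h1 : m * t <= m * (Q * n) by rewrite ler_wpM2l.
    have h2 : 0 <= n * (1 - 2 * Q * m) by rewrite mulr_ge0// subr_ge0.
    by lra.
  exists (resolvent W p h); rewrite -hE.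
  have := resolventP h bp; congr W; congr pair => /=.
  by rewrite /V -addrA -scalerDl opprB subrK.
have Wf' : W (f, (x + (z - p) *: f) + p *: f).
  by rewrite -addrA -scalerDl subrK.
have := bp.2 _ _ Wf'.
have := form_normD hip complete_ip x ((z - p) *: f).
rewrite form_normZ//; have := form_norm_ge0 ip f; have := modc_ge0 (z - p).
have := form_norm_ge0 ip x.
move: (N (_ + _)) (N x) (N f) (modc _) zp => a b c m zp.
move=> b0 m0 c0 h1 h2.
have h3 : Q * a <= Q * (b + m * c) by rewrite ler_wpM2l.
by nra.
Qed.

(** Writing [T(z)] for the resolvent, the resolvent identity shows that the divided differences of
    [T(z) a] with all nodes at [p] are [T(z) T(p)^n a]. A resolvent bound uniform near [p] bounds
    them geometrically. *)
Lemma resolvent_analytic p Q (l : K -> C) (L : R) a : 0 <= Q -> 0 <= L ->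
  (\forall z \near p, bounded_resolvent N W z Q) ->
  (forall c x y, l (c *: x + y) = c * l x + l y) ->
  (forall x, modc (l x) <= L * N x) ->
  analytic_at (fun z => l (resolvent W z a)) p.
Proof.
move=> Q0 L0 br ll lL.
have bp := nbhs_singleton br.
exists (fun n z => l (resolvent W z (iter n (resolvent W p) a))).
exists (L * Q * N a), Q; split=> //.
apply: filterS br => z bz; split=> // n; split.
  by rewrite (resolvent_identity _ bz bp) addrC ll addrC.
apply: le_trans (lL _) _; rewrite -!mulrA ler_wpM2l//.
apply: le_trans (resolvent_bound _ bz) _; rewrite ler_wpM2l//.
elim: n => [|n IH]; first by rewrite expr0 mulr1.
rewrite iterS; apply: le_trans (resolvent_bound _ bp) _.
by rewrite exprS mulrCA ler_wpM2l.
Qed.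

End Resolvent.

(** * The Hilbert space of a fundamental decomposition *)

Section Krein.
Context {R : realType} {K : lmodType R[i]}.
Local Notation C := R[i].
Implicit Types (x y f g : K) (z p : C) (W : set (K * K)).
Context (ip : K -> K -> C).
Hypothesis hip : hermitian_form ip.

Context (X Y : set K).
Hypothesis fd : fundamental_decomposition ip X Y.

Let sX : is_subspace X. Proof. by case: fd => -[]. Qed.
Let sY : is_subspace Y. Proof. by case: fd => -[]. Qed.
Let orthXY x y : X x -> Y y -> ip x y = 0.
Proof. by case: fd => -[_ _ _ _ + _ _]; exact. Qed.

Lemma proj_alongP x : X (proj_along X Y x) /\ Y (x - proj_along X Y x).
Proof.
case: fd => -[_ _ XYT _ _] _ _.
have [a Xa [b Yb abx]] : [set a + b | a in X & b in Y] x by rewrite -XYT.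
apply: (xgetPex 0 (ex_intro (fun y => X y /\ Y (x - y)) a _)).
by rewrite -abx addrC addKr.
Qed.

Lemma proj_along_eq x a : X a -> Y (x - a) -> proj_along X Y x = a.
Proof.
move=> Xa Yxa; have [Xp Yp] := proj_alongP x.
case: fd => -[_ _ _ XY0 _] _ _; apply/eqP; rewrite -subr_eq0; apply/eqP.
rewrite -[_ = 0]/([set 0] _) -XY0; split; first exact: subspaceB.
by have := subspaceB sY Yxa Yp; rewrite opprB addrC subrKA addrC.
Qed.

Lemma proj_along_linear : linear_map (proj_along X Y).
Proof.
move=> a x y; have [Xx Yx] := proj_alongP x; have [Xy Yy] := proj_alongP y.
apply: proj_along_eq; first exact: sX.2.
by rewrite opprD addrACA -scalerBr; exact: sY.2.
Qed.

Local Notation P := (proj_along X Y).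

Definition hilbert_form x y := ip (P x) (P y) - ip (x - P x) (y - P y).

Lemma hilbert_form_hermitian : hermitian_form hilbert_form.
Proof.
split=> [a x y z|x y]; rewrite /hilbert_form.
  rewrite proj_along_linear opprD addrACA -scalerBr !(ip_linl hip); ring.
by rewrite rmorphB /= -!(ip_herm hip).
Qed.

Lemma projX x : X x -> P x = x.
Proof. by move=> Xx; apply: proj_along_eq => //; rewrite subrr; exact: sY.1. Qed.

Lemma projY x : Y x -> P x = 0.
Proof. by move=> Yx; apply: proj_along_eq; rewrite ?subr0//; exact: sX.1. Qed.

Lemma hilbert_formX x y : X x -> hilbert_form x y = ip x y.
Proof.
move=> Xx; rewrite /hilbert_form projX// subrr (ip0l hip) subr0.
rewrite -{2}[y](subrK (P y)) (ipDr hip).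
by rewrite (orthXY Xx (proj_alongP y).2) add0r.
Qed.

Lemma hilbert_formY x y : Y x -> hilbert_form x y = - ip x y.
Proof.
move=> Yx; rewrite /hilbert_form projY// (ip0l hip) subr0 sub0r; congr (- _).
by rewrite (ipBr hip) [ip x (P y)](ip_herm hip) (orthXY (proj_alongP y).1 Yx) rmorph0 subr0.
Qed.

Lemma proj_norm x : form_norm ip (P x) <= form_norm hilbert_form x /\
  form_norm (opp_form ip) (x - P x) <= form_norm hilbert_form x.
Proof.
have [Xx Yx] := proj_alongP x; case: fd => _ [_ posX _] [_ posY _].
have hX : 0 <= complex.Re (ip (P x) (P x)).
  have [->|P0] := eqVneq (P x) 0; first by rewrite (ip0l hip).
  by have := posX _ Xx P0; rewrite ltcE => /andP[_ /ltW].
have hY : 0 <= complex.Re (opp_form ip (x - P x) (x - P x)).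
  have [->|P0] := eqVneq (x - P x) 0; first by rewrite /opp_form (ip0l hip) oppr0.
  by have := posY _ Yx P0; rewrite ltcE => /andP[_ /ltW].
by split; apply: ler_wsqrtr; move: hX hY;
  rewrite /hilbert_form /opp_form raddfB !raddfN/=; lra.
Qed.

Lemma hilbert_norm_le x : form_norm hilbert_form x <=
  form_norm ip (P x) + form_norm (opp_form ip) (x - P x).
Proof.
have [Xx Yx] := proj_alongP x; case: fd => _ [_ posX _] [_ posY _].
have hX : 0 <= complex.Re (ip (P x) (P x)).
  have [->|P0] := eqVneq (P x) 0; first by rewrite (ip0l hip).
  by have := posX _ Xx P0; rewrite ltcE => /andP[_ /ltW].
have hY : 0 <= complex.Re (opp_form ip (x - P x) (x - P x)).
  have [->|P0] := eqVneq (x - P x) 0; first by rewrite /opp_form (ip0l hip) oppr0.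
  by have := posY _ Yx P0; rewrite ltcE => /andP[_ /ltW].
have hs : complex.Re (hilbert_form x x) = complex.Re (ip (P x) (P x)) +
  complex.Re (opp_form ip (x - P x) (x - P x)) by rewrite -raddfD.
rewrite /form_norm hs.
move: (complex.Re _) (complex.Re _) hX hY => u v u0 v0.
rewrite -(@ler_sqr _ (Num.sqrt _)) ?nnegrE ?addr_ge0 ?sqrtr_ge0//.
rewrite sqrrD !sqr_sqrtr ?addr_ge0// addrAC lerDl mulrn_wge0//.
Qed.

Lemma hilbert_form_complete : hilbert_on hilbert_form setT.
Proof.
have [_ [_ posX cX] [_ posY cY]] := fd.
have BP x y : P (x - y) = P x - P y.
  by rewrite addrC -scaleN1r proj_along_linear scaleN1r addrC.
have BQ x y : (x - y) - P (x - y) = (x - P x) - (y - P y).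
  by rewrite BP !opprD !opprK addrACA.
split=> [//|x _ x0|u _ uc].
  have [Xx Yx] := proj_alongP x; rewrite /hilbert_form.
  have [Px0|Px0] := eqVneq (P x) 0.
    by rewrite Px0 (ip0l hip) subr0 sub0r; apply: posY => //; rewrite -[x]subr0 -Px0.
  have [Qx0|Qx0] := eqVneq (x - P x) 0.
    by rewrite Qx0 (ip0l hip) subr0; exact: posX.
  by apply: addr_gt0; [exact: posX|exact: posY].
have [|e e0|a Xa ua] := cX (fun n => P (u n)).
- by move=> n; have [] := proj_alongP (u n).
- have [n0 Hn] := uc e e0; exists n0 => m n m0 nn0; rewrite -BP.
  by apply: le_lt_trans (Hn _ _ m0 nn0); have [] := proj_norm (u m - u n).
have [|e e0|b Yb ub] := cY (fun n => u n - P (u n)).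
- by move=> n; have [] := proj_alongP (u n).
- have [n0 Hn] := uc e e0; exists n0 => m n m0 nn0; rewrite -BQ.
  by apply: le_lt_trans (Hn _ _ m0 nn0); have [] := proj_norm (u m - u n).
exists (a + b) => //.
have Pab : P (a + b) = a by apply: proj_along_eq; rewrite // addrC addKr.
have sub n : form_norm hilbert_form (u n - (a + b)) <=
    form_norm ip (P (u n) - a) + form_norm (opp_form ip) (u n - P (u n) - b).
  by apply: le_trans (hilbert_norm_le _) _; rewrite BQ BP Pab [a + b]addrC addrK.
apply: (@squeeze_cvgr _ _ _ _ (fun=> 0) (fun n =>
  form_norm ip (P (u n) - a) + form_norm (opp_form ip) (u n - P (u n) - b))).
- by apply: nearW => n; rewrite form_norm_ge0 sub.
- exact: cvg_cst.
- by rewrite -[0 in X in _ --> X]addr0; exact: cvgD.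
Qed.

Lemma krein_normE : krein_norm ip X Y = form_norm hilbert_form.
Proof. by apply/funext => x; rewrite /krein_norm /form_norm /hilbert_form raddfB. Qed.

(** The second argument is [y] under the fundamental symmetry. Through this identity, results on the
    Hilbert product pass to the indefinite form. *)
Lemma form_hilbertE x y : ip x y = hilbert_form x (P y - (y - P y)).
Proof.
have [Xx Yx] := proj_alongP x; have [Xy Yy] := proj_alongP y.
rewrite (ipBr hilbert_form_hermitian) [hilbert_form x (P y)](ip_herm hilbert_form_hermitian).
rewrite [hilbert_form x (y - _)](ip_herm hilbert_form_hermitian).
rewrite hilbert_formX// hilbert_formY// rmorphN /= opprK -!(ip_herm hip).
by rewrite -(ipDr hip) addrC subrK.
Qed.

(** The fundamental symmetry preserves the Hilbert norm, so this is Cauchy-Schwarz for the Hilbert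
    product. *)
Lemma ip_bound x y : modc (ip x y) <= form_norm hilbert_form x * form_norm hilbert_form y.
Proof.
have [Xy Yy] := proj_alongP y.
rewrite form_hilbertE.
have := ip_CauchySchwarz hilbert_form_hermitian hilbert_form_complete x (P y - (y - P y)).
move/le_trans; apply.
rewrite ler_wpM2l ?form_norm_ge0//; apply: ler_wsqrtr.
have PJ : P (P y - (y - P y)) = P y.
  by apply: proj_along_eq; rewrite // addrAC subrr add0r -scaleN1r; exact: subspaceZ.
rewrite /hilbert_form PJ [P y - _ - _]addrAC subrr add0r (ipNl hip) (ipNr hip) opprK.
by rewrite lexx.
Qed.

Lemma bounded_resolvent_in W z Q : is_subspace W ->
  bounded_resolvent (krein_norm ip X Y) W z Q -> resolvent_set ip W z.
Proof.
rewrite krein_normE => sW bW.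
have rl := resolvent_linear hilbert_form_hermitian hilbert_form_complete sW bW.
pose T := GRing.isLinear.Build C K K *:%R (resolvent W z) rl.
pose L : {linear K -> K} := HB.pack (resolvent W z) T.
exists L; split.
  apply/seteqP; split=> -[x y] /=; rewrite /rel_inv /rel_shift /=.
    by move/(resolvent_eq hilbert_form_hermitian hilbert_form_complete sW bW).
  by move=> ->; exact: resolventP bW.
exists X, Y; split=> //; exists Q => x.
by rewrite krein_normE; apply: resolvent_bound.
Qed.

End Krein.

(** * Resolvent sets in a Krein space *)

Section ResolventSet.
Context {R : realType} {K : lmodType R[i]} (ip : K -> K -> R[i]).
Hypothesis hip : hermitian_form ip.

(** Each point of the resolvent set brings its own fundamental decomposition, which is therefore
    part of the conclusion. *)
Lemma resolvent_set_bounded W z : resolvent_set ip W z -> exists X Y Q,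
  [/\ 0 <= Q, fundamental_decomposition ip X Y &
      bounded_resolvent (form_norm (hilbert_form ip X Y)) W z Q].
Proof.
move=> [T [TW [X [Y [fd [Q TQ]]]]]].
have TE x f : W (f, x + z *: f) <-> f = T x.
  have -> : W (f, x + z *: f) = rel_inv (rel_shift W z) (x, f) by [].
  by rewrite TW.
exists X, Y, `|Q|; split=> //; rewrite -krein_normE//; split=> [x|f x /TE ->].
  by exists (T x); apply/TE.
by apply: le_trans (TQ x) _; rewrite ler_wpM2r ?ler_norm// sqrtr_ge0.
Qed.

Lemma resolvent_set_open W p : is_subspace W -> resolvent_set ip W p ->
  exists X Y Q, [/\ 0 <= Q, fundamental_decomposition ip X Y &
    \forall z \near p, bounded_resolvent (form_norm (hilbert_form ip X Y)) W z Q].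
Proof.
move=> sW /resolvent_set_bounded[X [Y [Q [Q0 fd bp]]]].
exists X, Y, (2 * Q); split=> //; first by rewrite mulr_ge0.
have Q1 : 0 < 2 * Q + 1 by rewrite ltr_wpDl ?mulr_ge0.
apply/near_modcP; exists (2 * Q + 1)^-1; first by rewrite invr_gt0.
move=> z; rewrite -[_^-1]mul1r ltr_pdivlMr// => zp.
apply: bounded_resolvent_open bp Q0 _ => //.
- exact: hilbert_form_hermitian.
- exact: hilbert_form_complete.
- by have := modc_ge0 (z - p); nra.
Qed.

End ResolventSet.

(** * A dissipative extension and its finite-rank comparison *)

Section DissipativeExtension.
Context {R : realType} {K : lmodType R[i]}.
Local Notation C := R[i].
Implicit Types (x y f g w : K) (z : C) (p q u : K * K).
Context (ip : K -> K -> C).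
Hypothesis hip : hermitian_form ip.
Hypothesis complete_ip : hilbert_on ip setT.
Local Notation N := (form_norm ip).
Context (S : set (K * K)) (e : C).
Hypothesis sS : is_subspace S.
Hypothesis symS : forall p q, S p -> S q -> ip p.1 q.2 = ip p.2 q.1.
Hypothesis closedS : forall (u v : nat -> K) x y, (forall n, S (u n, v n)) ->
  N (u n - x) @[n --> \oo] --> (0 : R) ->
  N (v n - y) @[n --> \oo] --> (0 : R) -> S (x, y).
Hypothesis e1 : modc e = 1.
Hypothesis eJ : e^* = - e.

(* The orthogonal complement of the range of [S + e]. *)
Definition defect_space : set K :=
  [set w | forall p, S p -> ip w (p.2 + e *: p.1) = 0].

(** For [w] in the defect space, [(w, e *: w)] belongs to the adjoint of [S]. The relation is thus
    the extension of [S], inside its adjoint, by one of the two defect spaces of von Neumann's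
    formula. *)
Definition dissipative_extension : set (K * K) :=
  [set p | exists u w, [/\ S u, defect_space w & p = u + (w, e *: w)]].

Local Notation L := defect_space.
Local Notation B := dissipative_extension.

Lemma defect_subspace : is_subspace L.
Proof.
split=> [p _|a x y Lx Ly p Sp]; first exact: ip0l.
by rewrite (ip_linl hip) Lx// Ly// mulr0 addr0.
Qed.

Lemma extension_subspace : is_subspace B.
Proof.
split.
  exists 0, 0; split; [exact: sS.1|exact: defect_subspace.1|].
  by rewrite scaler0 (_ : (0, 0) = 0) ?addr0.
move=> a _ _ [u [w [Su Lw ->]]] [u' [w' [Su' Lw' ->]]].
exists (a *: u + u'), (a *: w + w'); split.
- exact: sS.2.
- exact: defect_subspace.2.
- congr pair => /=; rewrite !scalerDr; first by rewrite addrACA.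
  by rewrite addrACA !scalerA [a * e]mulrC.
Qed.

Lemma sub_extension : S `<=` B.
Proof.
move=> u Su; exists u, 0; split=> //; first exact: defect_subspace.1.
by rewrite scaler0 (_ : (0, 0) = 0) ?addr0.
Qed.

Lemma e_neq0 : e != 0.
Proof. by rewrite -modc_eq0 e1 oner_eq0. Qed.

Lemma Re_e : complex.Re e = 0.
Proof. by have /(congr1 (@complex.Re R)) := eJ; case: e => a b /=; lra. Qed.

Lemma ee : e * e = -1.
Proof.
apply: oppr_inj; rewrite opprK -mulrN -eJ -normCK -modcE e1 expr1n.
by [].
Qed.

Lemma sym_real p : S p -> complex.Im (ip p.1 p.2) = 0.
Proof.
move=> Sp; have := symS Sp Sp; rewrite [ip p.2 _](ip_herm hip).
by case: (ip _ _) => a b /= [] ; lra.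
Qed.

(** The mixed term drops out because [ip p.1 p.2] is real and [e] is imaginary. Both components of a
    pair in [S] are thus controlled by its image under [S + e]. *)
Lemma sym_norm p : S p -> N (p.2 + e *: p.1) ^+ 2 = N p.2 ^+ 2 + N p.1 ^+ 2.
Proof.
move=> Sp; rewrite (form_norm_sqrD hip complete_ip) (form_normZ hip complete_ip) e1 mul1r.
rewrite (ipZr hip) -(symS Sp Sp) eJ.
have := sym_real Sp; have := Re_e; case: (ip _ _) => a b; case: e => c d /= -> ->.
by ring.
Qed.

(** * The range of [S + e] and the resolvent of [B] at [- e] *)

Definition defect_range : set K := [set p.2 + e *: p.1 | p in S].

Lemma defect_range_subspace : is_subspace defect_range.
Proof.
split; first by exists 0; [exact: sS.1|rewrite /= scaler0 addr0].
move=> a _ _ [p Sp <-] [q Sq <-]; exists (a *: p + q); first exact: sS.2.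
by rewrite /= !scalerDr addrACA !scalerA [a * e]mulrC.
Qed.

(** When the images under [S + e] converge, [sym_norm] makes both components of the preimages
    Cauchy, and the limit pair lies in the closed relation [S]. *)
Lemma defect_range_closed : subspace_closed ip defect_range.
Proof.
move=> v x Mv vx.
have h n : exists q, S q /\ q.2 + e *: q.1 = v n.
  by have [q Sq <-] := Mv n; exists q.
have [p pP] := choice h.
have le1 q : S q -> N q.1 <= N (q.2 + e *: q.1).
  move=> Sq; rewrite -(@ler_sqr _ (N _)) ?nnegrE ?form_norm_ge0// sym_norm// lerDr.
  by rewrite sqr_ge0.
have le2 q : S q -> N q.2 <= N (q.2 + e *: q.1).
  move=> Sq; rewrite -(@ler_sqr _ (N _)) ?nnegrE ?form_norm_ge0// sym_norm// lerDl.
  by rewrite sqr_ge0.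
have uc (eps : R) : 0 < eps -> exists n0 : nat, forall m n : nat,
     (n0 <= m)%N -> (n0 <= n)%N -> N (v m - v n) < eps.
  move=> eps0; have [n0 Hn] := vx _ (divr_gt0 eps0 (ltr0n _ 2)).
  exists n0 => m n /Hn h1 /Hn h2.
  rewrite -(subrK x (v m)) -addrA; apply: le_lt_trans (form_normD hip complete_ip _ _) _.
  by rewrite (form_normBC hip complete_ip x); lra.
have pd m n : S (p m - p n) /\ (p m - p n).2 + e *: (p m - p n).1 = v m - v n.
  have [[Sm <-] [Sn <-]] := (pP m, pP n); split; first exact: subspaceB.
  by rewrite /= scalerBr addrACA opprD.
have [|a ua] := @complete_cauchy _ _ _ complete_ip (fun n => (p n).1).
  move=> eps /uc[n0 Hn]; exists n0 => m n m0 nn0; have [Sd dE] := pd m n.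
  by apply: le_lt_trans (Hn _ _ m0 nn0); rewrite -dE; exact: le1 Sd.
have [|b ub] := @complete_cauchy _ _ _ complete_ip (fun n => (p n).2).
  move=> eps /uc[n0 Hn]; exists n0 => m n m0 nn0; have [Sd dE] := pd m n.
  by apply: le_lt_trans (Hn _ _ m0 nn0); rewrite -dE; exact: le2 Sd.
have Sab : S (a, b).
  apply: (@closedS (fun n => (p n).1) (fun n => (p n).2)).
  - by move=> n; have [] := pP n; case: (p n).
  - by apply/form_norm_cvgP.
  - by apply/form_norm_cvgP.
exists (a, b) => //=; apply/eqP; rewrite -subr_eq0 -(form_norm_eq0 hip complete_ip).
apply/eqP/le_anti; rewrite form_norm_ge0 andbT; apply/ler_addgt0Pr => eps eps0.
have e3 := divr_gt0 eps0 (ltr0n R 3).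
have [[n0 H0] [n1 H1] [n2 H2]] := And3 (vx _ e3) (ua _ e3) (ub _ e3).
pose n := maxn n0 (maxn n1 n2).
have := H0 n (leq_maxl _ _).
have := H1 n (leq_trans (leq_maxl _ _) (leq_maxr _ _)).
have := H2 n (leq_trans (leq_maxr _ _) (leq_maxr _ _)).
have [_ uE] := pP n.
have -> : b + e *: a - x = - ((p n).2 - b) - e *: ((p n).1 - a) + (v n - x).
  by rewrite -uE scalerBr !opprB [X in _ = X + _]addrACA -opprD subrKA.
have := form_normD hip complete_ip (- ((p n).2 - b) - e *: ((p n).1 - a)) (v n - x).
have := form_normB hip complete_ip (- ((p n).2 - b)) (e *: ((p n).1 - a)).
rewrite (form_normN hip complete_ip) (form_normZ hip complete_ip) e1; lra.
Qed.

(** On the pairs [(w, e *: w)] the relation [B + e] is multiplication by [2 * e], so the part [l] of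
    [x] orthogonal to the range of [S + e] is reached by dividing it by [2 * e]. *)
Lemma extension_onto x : exists f, B (f, x - e *: f).
Proof.
have [m [u Su uE] ml] := projection hip complete_ip x defect_range_subspace defect_range_closed.
pose l := x - m.
have Ll : L l by move=> p Sp; apply: ml; exists p.
exists (u.1 + (2 * e)^-1 *: l), u, ((2 * e)^-1 *: l); split=> //.
  exact: subspaceZ defect_subspace Ll.
congr pair => /=.
rewrite scalerDr opprD !scalerA.
have -> : x = u.2 + e *: u.1 + l by rewrite uE /l addrC subrK.
have -> : e * (2 * e)^-1 = 2^-1 by field; exact: e_neq0.
rewrite addrACA addrK; congr (_ + _).
have {1}-> : l = 2^-1 *: l + 2^-1 *: l.
  by rewrite -scalerDl -[X in X + _]mul1r -[X in _ + X]mul1r -mulrDl divff ?scale1r// pnatr_eq0.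
by rewrite addrK.
Qed.

Lemma extension_dissipative p : B p -> 0 <= complex.Re (e * ip p.1 p.2).
Proof.
move=> [u [w [Su Lw ->]]] /=.
have := Lw _ Su; rewrite (ipDr hip) (ipZr hip) => h1.
have := sym_real Su; have := Re_e.
have := ip_ge0 hip complete_ip w; rewrite lecE /= => /andP[_].
rewrite !(ipDl hip) !(ipDr hip) !(ipZr hip).
have -> : ip w u.2 = e * ip w u.1.
  by apply/eqP; rewrite -subr_eq0 -mulNr -eJ h1.
rewrite eJ [ip u.1 w](ip_herm hip) => ww er ur.
(* As [e * e] is -1, the mixed terms form an imaginary number, and the real part that remains is
   that of [ip w w]. *)
have -> : e * (ip u.1 u.2 + - e * (ip w u.1)^* + (e * ip w u.1 + - e * ip w w)) =
   e * ip u.1 u.2 + e * e * (ip w u.1 - (ip w u.1)^*) - e * e * ip w w by ring.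
rewrite ee; move: er ur ww; case: (e) (ip u.1 u.2) (ip w u.1) (ip w w) => [a b] [c d] [k l] [s t] /=.
by move=> -> ->; lra.
Qed.

Lemma extension_norm_le z f x : half_plane e z -> B (f, x + z *: f) ->
  - complex.Re (e * z^*) * N f <= N x.
Proof.
move=> Dz /extension_dissipative /=.
rewrite (ipDr hip) (ipZr hip) (ip_sqr hip complete_ip) mulrDr raddfD /= mulrA.
have -> : complex.Re (e * z^* * (N f ^+ 2)%:C%C) = complex.Re (e * z^*) * N f ^+ 2.
  by case: (e * z^*) => a b /=; ring.
have h1 : complex.Re (e * ip f x) <= N f * N x.
  apply: le_trans (ler_norm _) _; apply: le_trans (Re_le_modc _) _.
  by rewrite modcM e1 mul1r ip_CauchySchwarz.
have := form_norm_ge0 ip f; rewrite le_eqVlt => /orP[/eqP <-|Nf].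
  by rewrite mulr0 form_norm_ge0.
move=> h2; have : 0 <= N f * (N x + complex.Re (e * z^*) * N f) by nra.
by rewrite pmulr_rge0// => h3; lra.
Qed.

Lemma half_plane_Ne : half_plane e (- e).
Proof.
rewrite /half_plane /= rmorphN /= eJ opprK ee /=; lra.
Qed.

Lemma extension_resolvent_Ne : bounded_resolvent N B (- e) 1.
Proof.
split=> [x|f x /(extension_norm_le half_plane_Ne)].
  by have [f Bf] := extension_onto x; exists f; rewrite scaleNr.
by rewrite rmorphN /= eJ opprK ee /= opprK !mul1r.
Qed.

(** * The Cayley transform and the resolvent on the half-plane *)

Let T := resolvent B (- e).
Let V x := x - (2 * e) *: T x.

Let V_linear : linear_map V.
Proof.
move=> a x y; rewrite /V /T (resolvent_linear hip complete_ip extension_subspace extension_resolvent_Ne).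
by rewrite scalerDr opprD addrACA scalerBr !scalerA [_ * a]mulrC.
Qed.

(** For the pair [(f, g)] of [B] with [f = T x], the two squared norms differ by four times the real
    part of [e * ip f g]; contractivity is dissipativity. *)
Let V_le x : N (V x) <= N x.
Proof.
rewrite -(@ler_sqr _ (N _)) ?nnegrE ?form_norm_ge0// /V.
have := resolventP x extension_resolvent_Ne; rewrite -/T => /extension_dissipative /=.
rewrite scaleNr; move: (T x) => f; move gE : (x - e *: f) => g h.
have -> : x = g + e *: f by rewrite -gE subrK.
have -> : g + e *: f - (2 * e) *: f = g - e *: f.
  by rewrite mulrDl mul1r scalerDl opprD addrA addrK.
rewrite !(form_norm_sqrD hip complete_ip) (form_normN hip complete_ip) (ipNr hip) (ipZr hip).
rewrite [ip g f](ip_herm hip) -rmorphM raddfN /=.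
have -> : complex.Re ((e * ip f g)^*) = complex.Re (e * ip f g) by case: (e * _).
by move: h; lra.
Qed.

(* [V] is the Cayley transform of [B]; up to a scalar factor, [B - z] is
   [1 + c V] with [c = (e + z) / (e - z)] of modulus less than 1. *)
Lemma extension_resolvent z : half_plane e z ->
  bounded_resolvent N B z (- complex.Re (e * z^*))^-1.
Proof.
move=> Dz; have d0 : 0 < - complex.Re (e * z^*) by rewrite oppr_gt0.
split=> [x|f x /(extension_norm_le Dz) h]; last by rewrite [leRHS]mulrC ler_pdivlMr// mulrC.
have sq : modc (e - z) ^+ 2 - modc (e + z) ^+ 2 = - 4 * complex.Re (e * z^*).
  by rewrite !modc_sqr; case: (e) (z) => a b [c d] /=; ring.
have ez : modc (e + z) < modc (e - z).
  rewrite -(@ltr_sqr _ (modc _)) ?nnegrE ?modc_ge0//.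
  by rewrite -subr_gt0 sq; move: d0; lra.
have ez0 : 0 < modc (e - z) by apply: le_lt_trans ez; exact: modc_ge0.
have ez1 : e - z != 0 by rewrite -modc_gt0.
pose c := (e + z) / (e - z).
(* With [k = 2 * e / (e - z) = 1 + c], the vector [h + c *: V h] is [k] times [h - (e + z) *: T h],
   the value of [B - z] at [T h]; hence the scalar in front of [x]. *)
have [|||h hE] := @neumann _ _ _ hip complete_ip (fun y => c *: V y) (modc c) _ _ _ ((2 * e / (e - z)) *: x).
- by move=> a u v; rewrite V_linear scalerDr !scalerA [a * c]mulrC.
- by rewrite modc_ge0 /c modcM modcV ltr_pdivrMr// mul1r.
- by move=> y; rewrite (form_normZ hip complete_ip) ler_wpM2l ?modc_ge0.
have := resolventP h extension_resolvent_Ne; rewrite -/T => BT.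
exists (T h); suff -> : x + z *: T h = h + - e *: T h by [].
apply: (@scalerI _ _ (2 * e / (e - z))).
  by rewrite !mulf_neq0 ?invr_eq0 ?e_neq0// pnatr_eq0.
rewrite scalerDr -hE /V -/T; move: (T h) => f.
have c1 : 2 * e / (e - z) = 1 + c by rewrite /c; field.
have c2 : 2 * e / (e - z) * (e + z) = 2 * e * c by rewrite /c; field.
set k := 2 * e / (e - z) in c1 c2 *.
have -> : h + c *: (h - (2 * e) *: f) = k *: h - (k * (e + z)) *: f.
  by rewrite c2 c1 scalerBr scalerDl scale1r scalerA [c * _]mulrC addrA.
rewrite mulrDr scalerDl opprD addrA scalerA subrK.
by rewrite scalerDr scalerA mulrN scaleNr.
Qed.

(** Within half the distance of [p] from the real axis, points keep at least half that distance. The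
    resulting uniform bound is what [resolvent_analytic] asks for. *)
Lemma extension_resolvent_near (p : C) : half_plane e p ->
  \forall z \near p, bounded_resolvent N B z (2 * (- complex.Re (e * p^*))^-1).
Proof.
move=> Dp; have d0 : 0 < - complex.Re (e * p^*) by rewrite oppr_gt0.
apply/near_modcP; exists (- complex.Re (e * p^*) / 2); first by rewrite divr_gt0.
move=> z zp.
have : `|complex.Re (e * (z - p)^*)| <= modc (z - p).
  by apply: le_trans (Re_le_modc _) _; rewrite modcM e1 mul1r modcJ.
rewrite rmorphB mulrBr raddfB /= ler_norml => /andP[_ h].
have dz : - complex.Re (e * p^*) / 2 < - complex.Re (e * z^*).
  by move: zp h; lra.
have Dz : half_plane e z by rewrite /half_plane /= -oppr_gt0; lra.
have [ex le] := extension_resolvent Dz; split=> // f x /le /le_trans; apply.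
rewrite ler_wpM2r ?form_norm_ge0// -[2]invrK -invfM.
rewrite lef_pV2 ?posrE; first by rewrite mulrC ltW.
  by lra.
by rewrite mulr_gt0// invr_gt0.
Qed.

(** The image of [u + (w, e *: w)] under [B + e] has the component [(2 * e) *: w] in [L];
    orthogonality to [L] forces [w = 0]. So [S] is cut out of [B] by as many conditions as [L] has
    dimensions. *)
Lemma sub_of_orthogonal p : B p -> (forall w, L w -> ip (p.2 + e *: p.1) w = 0) -> S p.
Proof.
move=> [u [w [Su Lw ->]]] /(_ w Lw) /=.
have -> : u.2 + e *: w + e *: (u.1 + w) = (u.2 + e *: u.1) + (2 * e) *: w.
  by rewrite scalerDr addrACA mulrDl mul1r scalerDl.
rewrite (ipDl hip) (ip_herm hip) Lw// rmorph0 add0r (ipZl hip) => /eqP.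
rewrite !mulf_eq0 (negbTE e_neq0) pnatr_eq0 (ip_eq0 hip complete_ip) /= => /eqP ->.
by rewrite scaler0 (_ : (0, 0) = 0) ?addr0.
Qed.

Lemma defect_orthogonal p w : S p -> L w -> ip (p.2 + e *: p.1) w = 0.
Proof. by move=> Sp Lw; rewrite (ip_herm hip) Lw ?rmorph0. Qed.

Lemma half_plane_neq z : half_plane e z -> e - z != 0.
Proof.
move=> Dz; rewrite subr_eq0; apply/eqP => zE; move: Dz.
by rewrite -zE /half_plane /= eJ mulrN ee opprK /=; lra.
Qed.

Lemma resolvent_defect w z : half_plane e z -> L w ->
  resolvent B z w = (e - z)^-1 *: w.
Proof.
move=> Dz Lw.
apply: (resolvent_eq hip complete_ip extension_subspace (extension_resolvent Dz)).
have ez := half_plane_neq Dz.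
exists 0, ((e - z)^-1 *: w); split; [exact: sS.1|exact: subspaceZ defect_subspace Lw|].
rewrite add0r; congr pair; rewrite !scalerA -{1}[w]scale1r -scalerDl; congr (_ *: _).
by field.
Qed.

(** * Analyticity and bounded type of the resolvent of [B] *)

Let TB := resolvent B.

Let TB_linear z : half_plane e z -> linear_map (TB z).
Proof. by move=> Dz; exact: (resolvent_linear hip complete_ip extension_subspace (extension_resolvent Dz)). Qed.

Lemma extension_analytic x y (p : C) : half_plane e p ->
  analytic_at (fun z => ip (TB z x) y) p.
Proof.
move=> Dp; apply: (resolvent_analytic hip complete_ip extension_subspace x _
  (form_norm_ge0 ip y) (extension_resolvent_near Dp) (l := ip ^~ y)).
- by rewrite mulr_ge0// invr_ge0 oppr_ge0 ltW.
- by move=> c u v; rewrite (ip_linl hip).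
- by move=> u; rewrite mulrC; exact: ip_CauchySchwarz.
Qed.

Lemma extension_diag_bt x : bt_analytic (half_plane e) (fun z => ip (TB z x) x).
Proof.
have H : bt_analytic (half_plane e) (fun z => e * ip (TB z x) x).
  apply: bt_analytic_Re_ge0 => [p Dp|z Dz].
    by apply: analyticM (analytic_cst _ _) _; exact: extension_analytic.
  have := resolventP x (extension_resolvent Dz); rewrite -/(TB z x).
  move: (TB z x) => f /extension_dissipative /=.
  rewrite (ipDr hip) (ipZr hip) (ip_sqr hip complete_ip) mulrDr raddfD /= mulrA.
  have -> : complex.Re (e * z^* * (N f ^+ 2)%:C%C) = complex.Re (e * z^*) * N f ^+ 2.
    by case: (e * z^*) => a b /=; ring.
  have : 0 <= - complex.Re (e * z^*) * N f ^+ 2.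
    by rewrite mulr_ge0 ?sqr_ge0// oppr_ge0 ltW.
  lra.
apply: eq_bt_analytic (bt_analyticM (bt_analytic_cst _ (- e)) H) => z.
by rewrite mulrA mulNr ee opprK mul1r.
Qed.

Lemma extension_bt x y : bt_analytic (half_plane e) (fun z => ip (TB z x) y).
Proof.
(* Polarization over the fourth roots of unity [1], [- 1], [e], [- e]. *)
pose F c := fun z => c * ip (TB z (x + c *: y)) (x + c *: y).
have HF c : bt_analytic (half_plane e) (F c).
  exact: bt_analyticM (bt_analytic_cst _ _) (extension_diag_bt _).
apply: (@eq_bt_analytic_in _ _ (fun z => 4^-1 * ((F 1 z + F (-1) z) + (F e z + F (- e) z)))).
- exact: half_plane_open.
- move=> z Dz; have TD c : TB z (x + c *: y) = TB z x + c *: TB z y.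
    by rewrite addrC TB_linear// addrC.
  rewrite /F !TD !(ipDl hip) !(ipDr hip) !(ipZl hip) !(ipZr hip).
  rewrite rmorphN1 rmorph1 rmorphN /= eJ opprK.
  move: (ip _ _) (ip _ _) (ip _ _) (ip _ _) => a b c d; have := ee; move: (e) => t tt.
  apply: (@mulfI _ 4); first by rewrite pnatr_eq0.
  rewrite mulrA mulfV ?pnatr_eq0// mul1r.
  apply/eqP; rewrite -subr_eq0; apply/eqP.
  transitivity ((1 + t * t) * (2 * b - 2 * c)); first by ring.
  by rewrite tt subrr mul0r.
- apply: bt_analyticM; first exact: bt_analytic_cst.
  by apply: bt_analyticD; apply: bt_analyticD.
Qed.

(** * Relations that extend [S] by two dimensions *)

Context (phi0 phi1 : K).
Hypothesis L_span : forall w, L w <-> exists a b, w = a *: phi0 + b *: phi1.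
Hypothesis phi_free : forall a b, a *: phi0 + b *: phi1 = 0 -> a = 0 /\ b = 0.

(* [defect_map z] is [(B + e)(B - z)^-1]; it maps the range of [S - z] onto the
   range of [S + e], that is, onto the orthogonal complement of [phi0], [phi1]. *)
Definition defect_map z x := x + (z + e) *: TB z x.

(* The value at [f] of [W - z], for the pair [p = (f, g)] of a relation [W]. *)
Definition rel_value z p := p.2 - z *: p.1.

Lemma rel_value_linear z a p q : rel_value z (a *: p + q) = a *: rel_value z p + rel_value z q.
Proof.
rewrite /rel_value /= !scalerDr !scalerN !opprD addrACA.
by rewrite !scalerA [z * a]mulrC.
Qed.

Lemma rel_valueD z p q : rel_value z (p + q) = rel_value z p + rel_value z q.
Proof. by rewrite -[p]scale1r rel_value_linear !scale1r. Qed.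

Lemma rel_valueZ z a p : rel_value z (a *: p) = a *: rel_value z p.
Proof.
rewrite -[a *: p]addr0 rel_value_linear [rel_value z 0](_ : _ = 0) ?addr0//.
by rewrite /rel_value scaler0 subr0.
Qed.

Lemma rel_value_inj z p q : p.1 = q.1 -> rel_value z p = rel_value z q -> p = q.
Proof.
rewrite /rel_value; case: p q => p1' p2 [q1 q2] /= -> /(congr1 (fun x => x + z *: q1)).
by rewrite !subrK => ->.
Qed.

Lemma rel_value_pair z f x : rel_value z (f, x + z *: f) = x.
Proof. by rewrite /rel_value /= addrK. Qed.

Let L0 : L phi0. Proof. by apply/L_span; exists 1, 0; rewrite scale1r scale0r addr0. Qed.
Let L1 : L phi1. Proof. by apply/L_span; exists 0, 1; rewrite scale1r scale0r add0r. Qed.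

Lemma defect_map_linear z : half_plane e z -> linear_map (defect_map z).
Proof.
move=> Dz a x y; rewrite /defect_map TB_linear// !scalerDr addrACA !scalerA.
by rewrite [a * _]mulrC.
Qed.

Lemma sub_defect_map z x : half_plane e z ->
  ip (defect_map z x) phi0 = 0 -> ip (defect_map z x) phi1 = 0 ->
  S (TB z x, x + z *: TB z x).
Proof.
move=> Dz h0 h1; apply: sub_of_orthogonal.
  exact: resolventP (extension_resolvent Dz).
move=> w /L_span[a [b ->]] /=; rewrite -addrA -scalerDl.
by rewrite (ipDr hip) !(ipZr hip) h0 h1 !mulr0 addr0.
Qed.

Lemma defect_map_sub z u : half_plane e z -> S u ->
  TB z (rel_value z u) = u.1 /\ forall w, L w -> ip (defect_map z (rel_value z u)) w = 0.
Proof.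
move=> Dz Su; have E : TB z (rel_value z u) = u.1.
  apply: (resolvent_eq hip complete_ip extension_subspace (extension_resolvent Dz)).
  by apply: sub_extension; rewrite /rel_value subrK; case: (u) Su.
split=> // w Lw; rewrite /defect_map E /rel_value.
by rewrite -addrA -scaleNr -scalerDl addKr defect_orthogonal.
Qed.

Lemma defect_map_defect z w : half_plane e z -> L w ->
  defect_map z w = (2 * e / (e - z)) *: w.
Proof.
move=> Dz Lw; rewrite /defect_map /TB (resolvent_defect Dz Lw) scalerA.
rewrite -{1}[w]scale1r -scalerDl; congr (_ *: _).
by field; exact: half_plane_neq Dz.
Qed.

(** Since [A - z] is bijective, [A] is [S] plus preimages of a complement of the range of [S - z].
    The map [defect_map z] shows that [L] is such a complement, so [p0] and [p1] are taken over
    [phi0] and [phi1]. *)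
Lemma relation_basis (A : set (K * K)) z : is_subspace A -> S `<=` A ->
  half_plane e z -> (forall x, exists f, A (f, x + z *: f)) ->
  (forall f, A (f, z *: f) -> f = 0) ->
  exists p0 p1, [/\ A p0, A p1,
    forall p, A p -> exists u a b, S u /\ p = u + (a *: p0 + b *: p1) &
    forall a b, S (a *: p0 + b *: p1) -> a = 0 /\ b = 0].
Proof.
move=> sA SA Dz onto inj.
have ez := half_plane_neq Dz.
have [f0 A0] := onto phi0; have [f1 A1] := onto phi1.
exists (f0, phi0 + z *: f0), (f1, phi1 + z *: f1); split=> // [p Ap|a b].
  have [m [q Sq qm] ml] := projection hip complete_ip (defect_map z (rel_value z p))
    defect_range_subspace defect_range_closed.
  (* The scalar undoes the factor [2 * e / (e - z)] by which [defect_map z] acts on [L]; subtracting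
     [l] then leaves the part [m] in the range of [S + e]. *)
  pose l := ((e - z) / (2 * e)) *: (defect_map z (rel_value z p) - m).
  have Ll : L l by apply: subspaceZ defect_subspace _ => r Sr; apply: ml; exists r.
  have xl : defect_map z (rel_value z p - l) = m.
    rewrite addrC -scaleN1r defect_map_linear// (defect_map_defect Dz Ll).
    rewrite [_ *: l](_ : _ = defect_map z (rel_value z p) - m) ?scaleN1r ?opprB ?subrK//.
    rewrite /l scalerA (_ : _ * _ = 1) ?scale1r//; field.
    by rewrite ez e_neq0.
  have [a [b lE]] := (L_span l).1 Ll.
  have Su : S (TB z (rel_value z p - l), rel_value z p - l + z *: TB z (rel_value z p - l)).
    by apply: sub_defect_map; rewrite // xl -qm; apply: defect_orthogonal.
  eexists; exists a, b; split; first exact: Su.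
  set u := (_, _) in Su *; set r := a *: _ + _.
  have Ar : A (p - u - r).
    by do 2?[apply: subspaceB => //]; [exact: SA|apply: subspaceD => //; exact: subspaceZ].
  have rv : rel_value z (p - u - r) = 0.
    rewrite -[- r]scaleN1r addrC rel_value_linear -[- u]scaleN1r [p + _]addrC rel_value_linear.
    rewrite /r rel_valueD !rel_valueZ !rel_value_pair -lE !scaleN1r opprB addrC subrK.
    by rewrite subrr.
  have r0 : p - u - r = 0.
    have r1 : (p - u - r).1 = 0.
      apply: inj; move: Ar; rewrite [X in A X -> _](_ : _ = ((p - u - r).1, (p - u - r).2))//.
      by move/eqP: rv; rewrite /rel_value subr_eq0 => /eqP ->.
    apply: (@rel_value_inj z); first by rewrite r1.
    by rewrite rv /rel_value scaler0 subr0.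
  by apply/eqP; rewrite -subr_eq0 opprD addrA r0.
move=> Sq; apply: phi_free.
have [_] := defect_map_sub Dz Sq.
rewrite rel_valueD !rel_valueZ !rel_value_pair; set l := a *: _ + _ => lo.
have Ll : L l by apply/L_span; exists a, b.
have := lo _ Ll; rewrite (defect_map_defect Dz Ll) (ipZl hip) => /eqP.
rewrite !mulf_eq0 invr_eq0 (negbTE ez) (negbTE e_neq0) pnatr_eq0 /=.
by rewrite (ip_eq0 hip complete_ip) => /eqP.
Qed.

(** * Cramer's rule for the resolvent of [A] *)

Context (A : set (K * K)) (p0 p1 : K * K).
Hypothesis sA : is_subspace A.
Hypothesis SA : S `<=` A.
Hypothesis Ap0 : A p0.
Hypothesis Ap1 : A p1.
Hypothesis A_span : forall p, A p -> exists u a b, S u /\ p = u + (a *: p0 + b *: p1).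
Hypothesis p_free : forall a b, S (a *: p0 + b *: p1) -> a = 0 /\ b = 0.

(** Pairing [defect_map z] with [phi0] and [phi1] removes the contribution of [S]; these numbers,
    for [p0] and [p1], are the coefficients of the remaining system for [a] and [b]. *)
Definition entry p w z := ip (defect_map z (rel_value z p)) w.
Definition resolvent_det z :=
  entry p0 phi0 z * entry p1 phi1 z - entry p0 phi1 z * entry p1 phi0 z.

Lemma relation_solve z f x : half_plane e z -> A (f, x + z *: f) -> exists a b,
  [/\ f = TB z (x - (a *: rel_value z p0 + b *: rel_value z p1)) + (a *: p0.1 + b *: p1.1),
      ip (defect_map z x) phi0 = a * entry p0 phi0 z + b * entry p1 phi0 z &
      ip (defect_map z x) phi1 = a * entry p0 phi1 z + b * entry p1 phi1 z].
Proof.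
move=> Dz /A_span[u [a [b [Su uE]]]]; exists a, b.
have xE : x - (a *: rel_value z p0 + b *: rel_value z p1) = rel_value z u.
  by have := congr1 (rel_value z) uE; rewrite rel_value_pair !rel_valueD !rel_valueZ => ->; rewrite addrK.
have [TE TL] := defect_map_sub Dz Su.
have DE w : L w -> ip (defect_map z x) w = a * entry p0 w z + b * entry p1 w z.
  move=> Lw; have := TL w Lw; rewrite -xE.
  have -> : x - (a *: rel_value z p0 + b *: rel_value z p1) =
    (- a) *: rel_value z p0 + ((- b) *: rel_value z p1 + x) by rewrite addrA addrC opprD !scaleNr.
  rewrite !(defect_map_linear Dz) !(ipDl hip) !(ipZl hip) -!/(entry _ _ _) => /eqP.
  by rewrite addrA !mulNr -opprD addrC subr_eq0 => /eqP.
split; [|exact: DE|exact: DE].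
by rewrite xE TE; have := congr1 fst uE.
Qed.

Lemma solve_relation z x a b : half_plane e z ->
  ip (defect_map z x) phi0 = a * entry p0 phi0 z + b * entry p1 phi0 z ->
  ip (defect_map z x) phi1 = a * entry p0 phi1 z + b * entry p1 phi1 z ->
  exists f, [/\ A (f, x + z *: f),
    f = TB z (x - (a *: rel_value z p0 + b *: rel_value z p1)) + (a *: p0.1 + b *: p1.1) &
    S ((f, x + z *: f) - (a *: p0 + b *: p1))].
Proof.
move=> Dz E0 E1.
set x' := x - (a *: rel_value z p0 + b *: rel_value z p1).
have DE w : ip (defect_map z x') w =
    ip (defect_map z x) w - (a * entry p0 w z + b * entry p1 w z).
  have -> : x' = (- a) *: rel_value z p0 + ((- b) *: rel_value z p1 + x).
    by rewrite addrA addrC /x' opprD !scaleNr.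
  rewrite !(defect_map_linear Dz) !(ipDl hip) !(ipZl hip) -!/(entry _ _ _).
  by rewrite addrA !mulNr -opprD addrC.
have Sx : S (TB z x', x' + z *: TB z x').
  by apply: sub_defect_map; rewrite // DE ?E0 ?E1 subrr.
set f := TB z x' + (a *: p0.1 + b *: p1.1).
have fE : (f, x + z *: f) - (a *: p0 + b *: p1) = (TB z x', x' + z *: TB z x').
  apply: (@rel_value_inj z); first by rewrite /= /f addrK.
  rewrite -[- (_ + _)]scaleN1r addrC rel_value_linear rel_value_pair scaleN1r addrC.
  by rewrite rel_valueD !rel_valueZ rel_value_pair.
exists f; split=> //; last by rewrite fE.
rewrite -(subrK (a *: p0 + b *: p1) (f, _)) fE.
apply: subspaceD => //; first exact: SA.
by apply: subspaceD => //; apply: subspaceZ.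
Qed.

(** A kernel vector [(a, b)] of the system produces some [f] with [(f, z *: f)] in [A]. Injectivity
    gives [f = 0], which puts [a *: p0 + b *: p1] into [S], so [a] and [b] vanish. *)
Lemma det_neq0 z : half_plane e z -> (forall f, A (f, z *: f) -> f = 0) ->
  resolvent_det z != 0.
Proof.
move=> Dz inj; apply/eqP => det0.
have kill a b : a * entry p0 phi0 z + b * entry p1 phi0 z = 0 ->
    a * entry p0 phi1 z + b * entry p1 phi1 z = 0 -> a = 0 /\ b = 0.
  have D0 w : ip (defect_map z 0) w = 0.
    have -> : defect_map z 0 = 0; last exact: ip0l.
    by apply: (addrI (defect_map z 0)); rewrite -{1}[defect_map z 0]scale1r -(defect_map_linear Dz) scaler0 !addr0.
  move=> h0 h1; have [||f [Af _ Sf]] := @solve_relation z 0 a b Dz.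
  - by rewrite D0 h0.
  - by rewrite D0 h1.
  rewrite add0r in Af Sf; move: Sf; rewrite (inj f Af) scaler0.
  rewrite (_ : (0, 0) - _ = - a *: p0 + - b *: p1); last first.
    by rewrite !scaleNr -opprD (_ : (0, 0) = 0) ?sub0r.
  by move=> /p_free[/eqP + /eqP]; rewrite !oppr_eq0 => /eqP-> /eqP->.
(* If the determinant is zero, the columns of the adjugate matrix are kernel vectors, hence zero;
   then [(1, 0)] is a kernel vector as well. *)
have [a1 b1] : entry p1 phi1 z = 0 /\ - entry p0 phi1 z = 0.
  by apply: kill; [rewrite -[RHS]det0 /resolvent_det; ring|ring].
have [c1 d1] : entry p1 phi0 z = 0 /\ - entry p0 phi0 z = 0.
  by apply: kill; [ring|rewrite -[RHS]oppr0 -det0 /resolvent_det; ring].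
have [] := kill 1 0.
- by rewrite mul0r addr0 mul1r; apply: oppr_inj; rewrite d1 oppr0.
- by rewrite mul0r addr0 mul1r; apply: oppr_inj; rewrite b1 oppr0.
by move=> /eqP; rewrite oner_eq0.
Qed.

Lemma entryE p w z : half_plane e z -> entry p w z =
  ip p.2 w - z * ip p.1 w + (z + e) * (ip (TB z p.2) w - z * ip (TB z p.1) w).
Proof.
move=> Dz; have TV : TB z (rel_value z p) = TB z p.2 - z *: TB z p.1.
  by rewrite /rel_value addrC -scaleNr TB_linear// addrC scaleNr.
by rewrite /entry /defect_map TV (ipDl hip) (ipZl hip) !(ipBl hip) !(ipZl hip).
Qed.

Lemma entry_bt p w : bt_analytic (half_plane e) (entry p w).
Proof.
apply: (@eq_bt_analytic_in _ _ (fun z =>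
  ip p.2 w - z * ip p.1 w + (z + e) * (ip (TB z p.2) w - z * ip (TB z p.1) w))).
- exact: half_plane_open.
- by move=> z Dz; rewrite entryE.
have cst c := bt_analytic_cst (half_plane e) c.
have id := bt_analytic_id e1.
by apply: bt_analyticD; [apply: bt_analyticB|apply: bt_analyticM;
  [apply: bt_analyticD|apply: bt_analyticB]] => //;
  try apply: bt_analyticM => //; exact: extension_bt.
Qed.

Lemma resolvent_det_bt : bt_analytic (half_plane e) resolvent_det.
Proof. by apply: bt_analyticB; apply: bt_analyticM; exact: entry_bt. Qed.

Lemma defect_map_bt x w : bt_analytic (half_plane e) (fun z => ip (defect_map z x) w).
Proof.
apply: (@eq_bt_analytic _ _ (fun z => ip x w + (z + e) * ip (TB z x) w)).
  by move=> z; rewrite /defect_map (ipDl hip) (ipZl hip).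
have cst c := bt_analytic_cst (half_plane e) c.
by apply: bt_analyticD => //; apply: bt_analyticM (extension_bt _ _);
  apply: bt_analyticD => //; exact: bt_analytic_id.
Qed.

Definition cramer0 x z := ip (defect_map z x) phi0 * entry p1 phi1 z -
  ip (defect_map z x) phi1 * entry p1 phi0 z.
Definition cramer1 x z := ip (defect_map z x) phi1 * entry p0 phi0 z -
  ip (defect_map z x) phi0 * entry p0 phi1 z.

Lemma cramerP z f x : half_plane e z -> resolvent_det z != 0 ->
  A (f, x + z *: f) ->
  f = TB z (x - (cramer0 x z / resolvent_det z *: rel_value z p0 +
                 cramer1 x z / resolvent_det z *: rel_value z p1)) +
      (cramer0 x z / resolvent_det z *: p0.1 + cramer1 x z / resolvent_det z *: p1.1).
Proof.
move=> Dz d0 /(relation_solve Dz)[a [b [fE E0 E1]]].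
have -> : cramer0 x z / resolvent_det z = a.
  apply: (mulIf d0); rewrite divfK// /cramer0 E0 E1 /resolvent_det; ring.
have -> // : cramer1 x z / resolvent_det z = b.
apply: (mulIf d0); rewrite divfK// /cramer1 E0 E1 /resolvent_det; ring.
Qed.

Lemma relation_onto z x : half_plane e z -> resolvent_det z != 0 ->
  exists f, A (f, x + z *: f).
Proof.
move=> Dz d0.
have [||f [Af _ _]] := @solve_relation z x (cramer0 x z / resolvent_det z)
  (cramer1 x z / resolvent_det z) Dz; last by exists f.
  by rewrite /cramer0 /cramer1; move: d0; rewrite /resolvent_det => d0; field.
by rewrite /cramer0 /cramer1; move: d0; rewrite /resolvent_det => d0; field.
Qed.

(** Cramer's formula adds to the bounded operator [TB z] a term of finite rank whose coefficients
    are bounded functionals of [x]. *)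
Lemma relation_bounded z : half_plane e z -> resolvent_det z != 0 ->
  exists Q, bounded_resolvent N A z Q.
Proof.
move=> Dz d0.
pose q := (- complex.Re (e * z^*))^-1.
have q0 : 0 <= q by rewrite invr_ge0 oppr_ge0 ltW.
have TN x : N (TB z x) <= q * N x := resolvent_bound x (extension_resolvent Dz).
pose E := 1 + modc (z + e) * q.
have E0 : 0 <= E by rewrite addr_ge0 ?mulr_ge0 ?modc_ge0.
have DN x w : modc (ip (defect_map z x) w) <= E * N w * N x.
  apply: le_trans (ip_CauchySchwarz hip complete_ip _ _) _.
  rewrite mulrAC ler_wpM2r ?form_norm_ge0//.
  apply: le_trans (form_normD hip complete_ip _ _) _.
  rewrite (form_normZ hip complete_ip) mulrDl mul1r lerD2l -mulrA ler_wpM2l ?modc_ge0//.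
have cr (w w' : K) (a b : C) : exists2 k : R, 0 <= k & forall x,
    modc ((ip (defect_map z x) w * a - ip (defect_map z x) w' * b) / resolvent_det z) <= k * N x.
  exists ((E * N w * modc a + E * N w' * modc b) / modc (resolvent_det z)).
    by rewrite mulr_ge0 ?invr_ge0 ?addr_ge0 ?mulr_ge0 ?form_norm_ge0 ?modc_ge0.
  move=> x; rewrite modcM modcV mulrAC ler_wpM2r ?invr_ge0 ?modc_ge0//.
  apply: le_trans (modcB _ _) _; rewrite !modcM mulrDl.
  by rewrite ![_ * modc _ * N x]mulrAC lerD ?ler_wpM2r ?modc_ge0.
have [k0 k00 K0] := cr phi0 phi1 (entry p1 phi1 z) (entry p1 phi0 z).
have [k1 k10 K1] := cr phi1 phi0 (entry p0 phi0 z) (entry p0 phi1 z).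
exists (q * (1 + (k0 * N (rel_value z p0) + k1 * N (rel_value z p1))) + (k0 * N p0.1 + k1 * N p1.1)).
split=> [x|f x /(cramerP Dz d0) ->]; first exact: relation_onto.
have nD := form_normD hip complete_ip; have nZ := form_normZ hip complete_ip.
have := K0 x; have := K1 x; rewrite -/(cramer0 x z) -/(cramer1 x z).
move: (cramer0 x z / _) (cramer1 x z / _) => a b hb ha.
have sub (v w : K) : N (a *: v + b *: w) <= (k0 * N v + k1 * N w) * N x.
  apply: le_trans (nD _ _) _; rewrite !nZ mulrDl.
  by rewrite ![_ * N _ * N x]mulrAC lerD ?ler_wpM2r ?form_norm_ge0.
apply: le_trans (nD _ _) _; rewrite mulrDl; apply: lerD (sub _ _).
apply: le_trans (TN _) _; rewrite -mulrA ler_wpM2l//.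
apply: le_trans (form_normB hip complete_ip _ _) _.
by rewrite mulrDl mul1r lerD2l.
Qed.

Lemma relation_bt x y : exists2 n, bt_analytic (half_plane e) n &
  forall z, half_plane e z -> resolvent_det z != 0 ->
    ip (resolvent A z x) y = n z / resolvent_det z.
Proof.
(* This is the formula of [cramerP], paired with [y] and multiplied by the determinant. *)
exists (fun z => ip (TB z x) y * resolvent_det z -
  (cramer0 x z * (ip (TB z p0.2) y - z * ip (TB z p0.1) y) +
   cramer1 x z * (ip (TB z p1.2) y - z * ip (TB z p1.1) y)) +
  (cramer0 x z * ip p0.1 y + cramer1 x z * ip p1.1 y)).
  have cst c := bt_analytic_cst (half_plane e) c.
  have id := bt_analytic_id e1.
  have c0 : bt_analytic (half_plane e) (cramer0 x).
    by apply: bt_analyticB; apply: bt_analyticM (entry_bt _ _); exact: defect_map_bt.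
  have c1 : bt_analytic (half_plane e) (cramer1 x).
    by apply: bt_analyticB; apply: bt_analyticM (entry_bt _ _); exact: defect_map_bt.
  have TT (u v : K) : bt_analytic (half_plane e) (fun z => ip (TB z u) y - z * ip (TB z v) y).
    by apply: bt_analyticB; [|apply: bt_analyticM => //]; exact: extension_bt.
  apply: bt_analyticD; last by apply: bt_analyticD; apply: bt_analyticM.
  apply: bt_analyticB; first by apply: bt_analyticM resolvent_det_bt; exact: extension_bt.
  by apply: bt_analyticD; apply: bt_analyticM.
move=> z Dz d0; have [Q bA] := relation_bounded Dz d0.
have TE q : TB z (rel_value z q) = TB z q.2 - z *: TB z q.1.
  by rewrite /rel_value addrC -scaleNr TB_linear// addrC scaleNr.
rewrite {1}(cramerP Dz d0 (resolventP x bA)).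
have TV a b v : TB z (x - (a *: v + b *: rel_value z p1)) =
    - a *: TB z v + (- b *: TB z (rel_value z p1) + TB z x).
  by rewrite addrC opprD -!scaleNr -addrA !TB_linear.
rewrite TV !TE !(ipDl hip) !(ipZl hip) !(ipBl hip) !(ipZl hip).
by field.
Qed.

End DissipativeExtension.

(** * The sum of the two symmetric operators *)

Section Reducible.
Context {R : realType} {K : lmodType R[i]}.
Local Notation C := R[i].
Context (ip : K -> K -> C).
Hypothesis hip : hermitian_form ip.
Context (X Y : set K).
Hypothesis fd : fundamental_decomposition ip X Y.
Local Notation h := (hilbert_form ip X Y).
Local Notation N := (form_norm h).
Local Notation P := (proj_along X Y).

Lemma has_dim1 (D : set K) : has_dim D 1 ->
  exists phi, [/\ D phi, phi != 0 & forall x, D x -> exists c, x = c *: phi].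
Proof.
move=> [b [Db b0 bs]]; exists (b ord0); split=> //.
  apply/eqP => b00; have := b0 (fun=> 1).
  rewrite big_ord1 b00 scaler0 => /(_ erefl ord0) /eqP.
  by rewrite oner_eq0.
by move=> x /bs[c ->]; exists (c ord0); rewrite big_ord1.
Qed.

Lemma hilbert_projl x y : h x y = ip (P x) y - ip (x - P x) y.
Proof.
have [Xp Yp] := proj_alongP fd x; have hh := hilbert_form_hermitian hip fd.
by rewrite -{1}[x](subrK (P x)) (ipDl hh) (hilbert_formY hip fd)// (hilbert_formX hip fd)// addrC.
Qed.

Lemma form_nondegenerate x : (forall y, ip x y = 0) -> x = 0.
Proof.
move=> x0; apply/eqP.
rewrite -(ip_eq0 (hilbert_form_hermitian hip fd) (hilbert_form_complete hip fd)).
by rewrite hilbert_projl !(ip_herm hip _ x) !x0 rmorph0 subrr.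
Qed.

Context (A : set (K * K)).
Hypothesis sA : is_subspace A.
Let SX := A `&` (X `*` X).
Let SY := A `&` (Y `*` Y).
Hypothesis SXP : closed_simple_symmetric11 ip X SX.
Hypothesis SYP : closed_simple_symmetric11 (opp_form ip) Y SY.

Definition reducing_part : set (K * K) := [set p + q | p in SX & q in SY].
Local Notation S := reducing_part.

Let sSX : is_subspace SX. Proof. by case: SXP => -[[]]. Qed.
Let sSY : is_subspace SY. Proof. by case: SYP => -[[]]. Qed.
Let sX : is_subspace X. Proof. by case: fd => -[]. Qed.
Let sY : is_subspace Y. Proof. by case: fd => -[]. Qed.

Lemma reducing_subspace : is_subspace S.
Proof.
split; first by exists 0; [exact: sSX.1|exists 0; [exact: sSY.1|rewrite addr0]].
move=> a _ _ [p Sp [q Sq <-]] [p' Sp' [q' Sq' <-]].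
exists (a *: p + p'); first exact: sSX.2.
by exists (a *: q + q'); [exact: sSY.2|rewrite scalerDr addrACA].
Qed.

Lemma reducing_sub : S `<=` A.
Proof. by move=> _ [p [Ap _] [q [Aq _] <-]]; exact: subspaceD. Qed.

(** The Hilbert product agrees with the form on [X] and with its opposite on [Y], so the symmetry of
    each summand survives the change, and mixed terms vanish by orthogonality. *)
Lemma reducing_symmetric p q : S p -> S q -> h p.1 q.2 = h p.2 q.1.
Proof.
have hh := hilbert_form_hermitian hip fd.
have symX u v : SX u -> SX v -> ip u.1 v.2 = ip u.2 v.1.
  by move=> Su Sv; case: SXP => -[_ /(_ _ Su)[_ _ /(_ _ Sv)]].
have symY u v : SY u -> SY v -> ip u.1 v.2 = ip u.2 v.1.
  by move=> Su Sv; case: SYP => -[_ /(_ _ Su)[_ _ /(_ _ Sv)/oppr_inj]].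
have orth x y : X x -> Y y -> h x y = 0.
  by move=> Xx Yy; rewrite (hilbert_formX hip fd)//; case: fd => -[_ _ _ _ + _ _]; apply.
have orth' x y : X x -> Y y -> h y x = 0.
  by move=> Xx Yy; rewrite (ip_herm hh) orth ?rmorph0.
move=> [u Su [v Sv <-]] [u' Su' [v' Sv' <-]] /=.
have [_ [/= Xu1 Xu2]] := Su; have [_ [/= Xu1' Xu2']] := Su'.
have [_ [/= Yv1 Yv2]] := Sv; have [_ [/= Yv1' Yv2']] := Sv'.
rewrite !(ipDl hh) !(ipDr hh) (orth u.1 v'.2)// (orth u.2 v'.1)// (orth' u'.2 v.1)// (orth' u'.1 v.2)//.
rewrite (hilbert_formX hip fd _ Xu1) (hilbert_formX hip fd _ Xu2).
rewrite (hilbert_formY hip fd _ Yv1) (hilbert_formY hip fd _ Yv2).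
by rewrite (symX u u')// (symY v v').
Qed.

Lemma proj_sum x y : X x -> Y y -> P (x + y) = x.
Proof. by move=> Xx Yy; apply: (proj_along_eq fd) => //; rewrite addrC addKr. Qed.

Lemma reducing_closed (u v : nat -> K) x y : (forall n, S (u n, v n)) ->
  N (u n - x) @[n --> \oo] --> (0 : R) ->
  N (v n - y) @[n --> \oo] --> (0 : R) -> S (x, y).
Proof.
move=> Suv ux vy.
have sub a b : P (a - b) = P a - P b /\ (a - b) - P (a - b) = (a - P a) - (b - P b).
  have E : P (a - b) = P a - P b.
    by rewrite addrC -scaleN1r (proj_along_linear fd) scaleN1r addrC.
  by split=> //; rewrite E !opprD !opprK addrACA.
have Sp n : SX (P (u n), P (v n)) /\ SY (u n - P (u n), v n - P (v n)).
  have [p Sp [q Sq [uE vE]]] := Suv n.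
  have [_ [/= X1 X2]] := Sp; have [_ [/= Y1 Y2]] := Sq.
  rewrite -uE -vE !proj_sum// [p.1 + _]addrC [p.2 + _]addrC !addrK.
  by case: (p) (q) Sp Sq => ? ? [? ?].
have lX w z : N (w n - z) @[n --> \oo] --> (0 : R) ->
    form_norm ip (P (w n) - P z) @[n --> \oo] --> (0 : R).
  move=> wz; apply: (squeeze_cvgr _ (cvg_cst 0) wz); apply: nearW => n.
  by rewrite form_norm_ge0 -(sub _ _).1; have [] := proj_norm hip fd (w n - z).
have lY w z : N (w n - z) @[n --> \oo] --> (0 : R) ->
    form_norm (opp_form ip) (w n - P (w n) - (z - P z)) @[n --> \oo] --> (0 : R).
  move=> wz; apply: (squeeze_cvgr _ (cvg_cst 0) wz); apply: nearW => n.
  by rewrite form_norm_ge0 -(sub _ _).2; have [] := proj_norm hip fd (w n - z).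
have [Xx Yx] := proj_alongP fd x; have [Xy Yy] := proj_alongP fd y.
exists (P x, P y).
  by case: SXP => _ _ cl _ _; apply: (cl _ _ _ _ (fun n => (Sp n).1)) => //; exact: lX.
exists (x - P x, y - P y).
  by case: SYP => _ _ cl _ _; apply: (cl _ _ _ _ (fun n => (Sp n).2)) => //; exact: lY.
by congr pair; rewrite /= addrC subrK.
Qed.

(** The defect space of the orthogonal sum splits along [X] and [Y]. Deficiency index (1, 1) on each
    side supplies one vector from each, for either value of [e]. *)
Lemma reducing_defect (e : C) : e = 'i \/ e = - 'i -> exists phi0 phi1,
  (forall w, defect_space h S e w <-> exists a b, w = a *: phi0 + b *: phi1) /\
  (forall a b, a *: phi0 + b *: phi1 = 0 -> a = 0 /\ b = 0).
Proof.
move=> ei; have eJ : e^* = - e.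
  by case: ei => ->; rewrite ?rmorphN /= conjCi ?opprK.
have hh := hilbert_form_hermitian hip fd.
pose DX := rel_ker (rel_shift (adjoint ip X SX) e).
pose DY := rel_ker (rel_shift (adjoint (opp_form ip) Y SY) e).
have [phi0 [D0 n0 span0]] : exists phi, [/\ DX phi, phi != 0 & forall x, DX x -> exists c, x = c *: phi].
  by apply: has_dim1; rewrite /DX; case: SXP => _ _ _ _ []; case: ei => ->.
have [phi1 [D1 n1 span1]] : exists phi, [/\ DY phi, phi != 0 & forall x, DY x -> exists c, x = c *: phi].
  by apply: has_dim1; rewrite /DY; case: SYP => _ _ _ _ []; case: ei => ->.
(* Because [e^* = - e], orthogonality to the range of [S + e] is the adjoint relation for
   [(w, e *: w)]. *)
have eqv w (q : K * K) : ip w (q.2 + e *: q.1) = 0 <-> ip w q.2 = ip (e *: w) q.1.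
  rewrite (ipDr hip) (ipZr hip) (ipZl hip) eJ mulNr.
  by split=> [/eqP|->]; [rewrite subr_eq0 => /eqP|rewrite subrr].
have DXP w : DX w <-> X w /\ forall q, SX q -> ip w (q.2 + e *: q.1) = 0.
  rewrite /DX /rel_ker /rel_shift /= add0r; split=> [[/= Xw _ H]|[Xw H]].
    by split=> // q /H /eqv.
  by split=> //= [|q /H /eqv//]; exact: subspaceZ.
have DYP w : DY w <-> Y w /\ forall q, SY q -> ip w (q.2 + e *: q.1) = 0.
  rewrite /DY /rel_ker /rel_shift /= add0r /opp_form; split=> [[/= Xw _ H]|[Xw H]].
    by split=> // q /H /oppr_inj /eqv.
  by split=> //= [|q /H /eqv ->//]; exact: subspaceZ.
have X0 : X phi0 by have [] := (DXP _).1 D0.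
have Y1 : Y phi1 by have [] := (DYP _).1 D1.
have LP w : defect_space h S e w <-> DX (P w) /\ DY (w - P w).
  have [Xw Yw] := proj_alongP fd w.
  have hX v : X v -> h w v = ip (P w) v.
    move=> Xv; rewrite hilbert_projl [ip (w - _) _](ip_herm hip).
    by case: fd => -[_ _ _ _ /(_ _ _ Xv Yw) -> _ _]; rewrite rmorph0 subr0.
  have hY v : Y v -> h w v = - ip (w - P w) v.
    move=> Yv; rewrite hilbert_projl.
    by case: fd => -[_ _ _ _ /(_ _ _ Xw Yv) -> _ _]; rewrite sub0r.
  split=> [Lw|[/DXP[_ dX] /DYP[_ dY]] _ [p Sp [q Sq <-]]].
    split; [apply/DXP|apply/DYP]; split=> // q Sq; have [_ [/= q1 q2]] := Sq.
      rewrite -hX; last by apply: subspaceD => //; exact: subspaceZ.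
      by apply: Lw; exists q => //; exists 0; [exact: sSY.1|rewrite addr0].
    apply: oppr_inj; rewrite oppr0 -hY; last by apply: subspaceD => //; exact: subspaceZ.
    by apply: Lw; exists 0; [exact: sSX.1|exists q => //; rewrite add0r].
  rewrite /= scalerDr addrACA (ipDr hh).
  have [_ [/= p1 p2]] := Sp; have [_ [/= q1 q2]] := Sq.
  rewrite hX; last by apply: subspaceD => //; exact: subspaceZ.
  rewrite hY; last by apply: subspaceD => //; exact: subspaceZ.
  by rewrite dX// dY// oppr0 addr0.
exists phi0, phi1; split=> [w|a b ab0].
  split=> [/LP[/span0[a aE] /span1[b bE]]|[a [b ->]]].
    by exists a, b; rewrite -aE -bE addrC subrK.
  apply/LP; rewrite proj_sum; [|exact: subspaceZ|exact: subspaceZ].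
  rewrite addrC addKr; split; [apply/DXP|apply/DYP]; split; try exact: subspaceZ.
    by move=> q Sq; rewrite (ipZl hip) ((DXP _).1 D0).2// mulr0.
  by move=> q Sq; rewrite (ipZl hip) ((DYP _).1 D1).2// mulr0.
have := proj_sum (subspaceZ a sX X0) (subspaceZ b sY Y1); rewrite ab0.
have P0 : P 0 = 0 by rewrite (projX fd)//; exact: sX.1.
rewrite P0 => a0; move: ab0; rewrite -a0 add0r => b0.
have /esym/eqP := a0; move/eqP: b0; rewrite !scaler_eq0 (negbTE n0) (negbTE n1) !orbF.
by move=> /eqP -> /eqP ->.
Qed.

End Reducible.

(** * Partially fundamentally reducible relations *)

Section PartiallyFundamentallyReducible.
Context {R : realType} {K : lmodType R[i]}.
Local Notation C := R[i].
Context (ip : K -> K -> C) (A : set (K * K)).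
Hypothesis hip : hermitian_form ip.
Hypothesis pfr : partially_fundamentally_reducible ip A.
Local Notation rho := (resolvent_set ip A).

Let selfA : A = adjoint ip setT A. Proof. by case: pfr => -[]. Qed.
Let sA : is_subspace A. Proof. by case: pfr => -[[]]. Qed.

Lemma self_adjoint_eq p q : A p -> A q -> ip p.1 q.2 = ip p.2 q.1.
Proof. by rewrite {1}selfA => -[_ _]; exact. Qed.

Lemma resolvent_set_onto z : rho z -> forall x, exists f, A (f, x + z *: f).
Proof. by move=> /resolvent_set_bounded[? [? [? [_ _ []]]]]. Qed.

Lemma resolvent_set_inj z : rho z -> forall f, A (f, z *: f) -> f = 0.
Proof.
move=> /resolvent_set_bounded[X [Y [Q [_ fd bz]]]] f Af.
have hh := hilbert_form_hermitian hip fd; have ch := hilbert_form_complete hip fd.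
apply: (bounded_resolvent_uniq hh ch sA bz (x := 0)); first by rewrite add0r.
by rewrite scaler0 addr0; exact: sA.1.
Qed.

(** Self-adjointness makes an eigenvector for [z^*] orthogonal to the range of [A - z], which is the
    whole space, and the form is nondegenerate. This supplies a nonzero value of the determinant in
    the half-plane opposite to the known point. *)
Lemma resolvent_setJ_inj z : rho z -> forall f, A (f, z^* *: f) -> f = 0.
Proof.
move=> rz f Af; case: pfr => _ _ [X [Y [fd _ _]]].
apply: (form_nondegenerate hip fd) => y.
have [g Ag] := resolvent_set_onto rz y.
have /= := self_adjoint_eq Af Ag.
rewrite (ipDr hip) (ipZr hip) (ipZl hip) => /eqP.
by rewrite -subr_eq0 addrK => /eqP.
Qed.

Lemma resolvent_set_near z : rho z -> \forall w \near z, rho w.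
Proof.
move=> /(resolvent_set_open hip sA)[X [Y [Q [_ fd bz]]]].
apply: filterS bz => w bw; apply: (bounded_resolvent_in hip fd sA (Q := Q)).
by rewrite krein_normE.
Qed.

Lemma nonreal_half_plane z : nonreal z -> half_plane ('i : C) z \/ half_plane (- 'i : C) z.
Proof.
rewrite /nonreal /half_plane /= -complexiE; case: z => a b /=.
by rewrite neq_lt => /orP[] b0; [left|right]; lra.
Qed.

Lemma half_plane_i : half_plane ('i : C) = @lower_half_plane R.
Proof.
apply/seteqP; split=> z; rewrite /half_plane /lower_half_plane /= -complexiE;
  by case: z => a b /=; lra.
Qed.

Lemma half_plane_Ni : half_plane (- 'i : C) = @upper_half_plane R.
Proof.
apply/seteqP; split=> z; rewrite /half_plane /upper_half_plane /= -complexiE;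
  by case: z => a b /=; lra.
Qed.

Lemma half_planeJ (e z : C) : e = 'i \/ e = - 'i -> half_plane e z -> half_plane (- e) z^*.
Proof.
move=> ei; rewrite /half_plane /=; case: ei => ->; rewrite -complexiE; case: z => a b /=; lra.
Qed.

Lemma resolvent_set_nonreal : exists2 z, nonreal z & rho z.
Proof.
case: pfr => _ [z rz] _.
have [nz|] := eqVneq (complex.Im z) 0; last by move=> nz; exists z.
have /near_modcP[r r0 H] := resolvent_set_near rz.
exists (z + (r / 2)%:C%C * 'i).
  rewrite /nonreal /= -complexiE; case: z nz {rz H} => a b /= ->.
  by rewrite add0r !mul0r mulr1 addr0 gt_eqF// divr_gt0.
apply: H; rewrite addrC addKr modcM modc_real ger0_norm ?divr_ge0 ?ltW//.
have -> : modc ('i : C) = 1 by rewrite /modc normCi.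
by rewrite mulr1 ltr_pdivrMr ?ltr_pMr ?ltr1n.
Qed.

Lemma half_plane_resolvent_set (e : C) : e = 'i \/ e = - 'i -> exists d : C -> C,
  [/\ bt_analytic (half_plane e) d,
      exists2 z, half_plane e z & d z != 0,
      forall z, half_plane e z -> d z != 0 -> rho z &
      forall v, exists2 n, bt_analytic (half_plane e) n &
        forall z, half_plane e z -> d z != 0 ->
          ip (resolvent A z v) v = n z / d z].
Proof.
have unit (e' : C) : e' = 'i \/ e' = - 'i -> modc e' = 1 /\ e'^* = - e'.
  by case=> ->; rewrite ?modcN ?rmorphN /= conjCi ?opprK /modc normCi.
have [m nm rm] := resolvent_set_nonreal.
case: (pfr) => _ _ [X [Y [fd SXP SYP]]].
have hh := hilbert_form_hermitian hip fd; have ch := hilbert_form_complete hip fd.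
have sS := reducing_subspace SXP SYP; have SA := reducing_sub (X := X) (Y := Y) sA.
have symS := reducing_symmetric hip fd SXP SYP.
have closedS := reducing_closed hip fd SXP SYP.
have [e0 [ei0 Dm]] : exists e0 : C, (e0 = 'i \/ e0 = - 'i) /\ half_plane e0 m.
  by case: (nonreal_half_plane nm) => ?; [exists 'i|exists (- 'i)]; split; auto.
(* The decomposition of [A] over [S] does not refer to a half-plane: pairs found at [m] with the
   defect vectors for [e0] remain valid for [e]. *)
have [p0 [p1 [A0 A1 Asp pfree]]] : exists p0 p1, [/\ A p0, A p1,
    forall p, A p -> exists u a b, reducing_part X Y A u /\ p = u + (a *: p0 + b *: p1) &
    forall a b, reducing_part X Y A (a *: p0 + b *: p1) -> a = 0 /\ b = 0].
  have [psi0 [psi1 [sp fr]]] := reducing_defect hip fd SXP SYP ei0.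
  have [u1 uJ] := unit e0 ei0.
  apply: (relation_basis hh ch sS symS closedS u1 uJ sp fr sA SA Dm).
    exact: resolvent_set_onto.
  exact: resolvent_set_inj.
move=> ei; have [e1 eJ] := unit e ei.
have [phi0 [phi1 [sp fr]]] := reducing_defect hip fd SXP SYP ei.
exists (resolvent_det (hilbert_form ip X Y) (reducing_part X Y A) e phi0 phi1 p0 p1); split.
- exact: resolvent_det_bt.
- have det := det_neq0 hh ch sS symS closedS e1 eJ sp sA SA A0 A1 pfree.
  have [De|De] : half_plane e m \/ half_plane e m^*.
    have := half_planeJ ei0 Dm; case: ei0 Dm => ->; case: ei => -> Dm; rewrite ?opprK; auto.
  + by exists m => //; apply: det => //; exact: resolvent_set_inj.
  + by exists m^* => //; apply: det => //; exact: resolvent_setJ_inj.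
- move=> z Dz d0.
  have [Q bQ] := relation_bounded hh ch sS symS closedS e1 eJ sp sA SA A0 A1 Asp Dz d0.
  by apply: (bounded_resolvent_in hip fd sA (Q := Q)); rewrite krein_normE.
(* The vector paired with the resolvent is [v] under the fundamental symmetry, which turns the
   Hilbert product into the indefinite form. *)
- move=> v; have [n nb nE] := relation_bt hh ch sS symS closedS e1 eJ sp sA SA A0 A1 Asp
    v (proj_along X Y v - (v - proj_along X Y v)).
  by exists n => // z Dz d0; rewrite (form_hilbertE hip fd) nE.
Qed.

Lemma det_neq0_near (e : C) d p : bt_analytic (half_plane e) d ->
  (exists2 z, half_plane e z & d z != 0) -> half_plane e p ->
  \forall z \near p^', d z != 0.
Proof.
move=> [ad _] [w Dw dw] Dp.
have [N [g [ag g0 dE]]] := identity_theorem ad Dw dw Dp.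
have gn := nonzero_near (analytic_continuous ag) g0.
rewrite near_withinE; apply: filterS2 dE gn => z -> gz zp.
by rewrite mulf_neq0// expf_neq0// subr_eq0.
Qed.

Lemma unit_i (e : C) : e = 'i \/ e = - 'i -> modc e = 1.
Proof. by case=> ->; rewrite ?modcN /modc normCi. Qed.

Lemma resolvent_set_punctured p : nonreal p -> \forall z \near p^', rho z.
Proof.
move=> /nonreal_half_plane np.
have [e [ei Dp]] : exists e : C, (e = 'i \/ e = - 'i) /\ half_plane e p.
  by case: np => ?; [exists 'i|exists (- 'i)]; split; auto.
have [d [bd nd dr _]] := half_plane_resolvent_set ei.
have dn := det_neq0_near bd nd Dp.
have Dn : \forall z \near p, half_plane e z.
  by apply: open_nbhs_nbhs; split=> //; apply: half_plane_open; exact: unit_i.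
move: dn; rewrite !near_withinE => dn; apply: filterS2 Dn dn => z Dz dz zp.
by apply: dr => //; exact: dz.
Qed.

Lemma spectrum_discrete : discrete_in (@nonreal R) (spectrum ip A `&` @nonreal R).
Proof.
move=> p np lp; have := resolvent_set_punctured np; rewrite near_withinE => H.
by have [z [zp [sz _] rz]] := lp _ H; exact/sz/rz.
Qed.

Lemma resolvent_form_analytic v p : rho p ->
  analytic_at (fun z => ip (resolvent A z v) v) p.
Proof.
move=> /(resolvent_set_open hip sA)[X [Y [Q [Q0 fd bp]]]].
have hh := hilbert_form_hermitian hip fd; have ch := hilbert_form_complete hip fd.
apply: (resolvent_analytic hh ch sA v Q0 (form_norm_ge0 (hilbert_form ip X Y) v) bp (l := ip ^~ v)).
- by move=> c x y; rewrite (ip_linl hip).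
- by move=> x; rewrite mulrC; exact: ip_bound.
Qed.

(** * The realized function *)

Context (v : K) (U : set C) (q : C -> C) (z0 : C).
Hypothesis oU : open U.
Hypothesis holq : holomorphic_on U q.
Hypothesis real : is_realization ip A v U q z0.
Local Notation f := (realization_extension ip A v U q z0).
Local Notation F := (realization_formula ip A v q z0).
Local Notation dom := (U `|` rho).

Lemma realization_formulaE z : F z =
  ((q z0)^* + (z - z0^*) * ip v v) + (z - z0^*) * (z - z0) * ip (resolvent A z v) v.
Proof. by rewrite /realization_formula (ipDl hip) (ipZl hip); ring. Qed.

Lemma extensionE z : rho z -> f z = F z.
Proof.
move=> rz; rewrite /realization_extension; case: ifPn => // /set_mem Uz.
by case: real => _ _ _; apply.
Qed.

Lemma formula_analytic p : rho p -> analytic_at F p.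
Proof.
move=> rp; apply: analytic_near (_ : \forall z \near p,
  ((q z0)^* + (z - z0^*) * ip v v) + (z - z0^*) * (z - z0) * ip (resolvent A z v) v = F z) _.
  by apply: filterE => z; rewrite realization_formulaE.
have cst c := analytic_cst c p; have id := analytic_id p.
apply: analyticD; first by apply: analyticD => //; apply: analyticM => //; exact: analyticB.
by apply: analyticM (resolvent_form_analytic v rp); apply: analyticM; exact: analyticB.
Qed.

Lemma extension_derivable p : dom p -> derivable f p 1.
Proof.
move=> [Up|rp].
  have : \forall z \near p, q z = f z.
    have Un : \forall z \near p, U z by exact: open_nbhs_nbhs.
    by apply: filterS Un => z Uz; rewrite /realization_extension mem_set.
  by move/near_eq_derivable; apply; exact: holq.
have : \forall z \near p, F z = f z.
  by apply: filterS (resolvent_set_near rp) => z rz; rewrite extensionE.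
by move/near_eq_derivable; apply; exact/analytic_derivable/formula_analytic.
Qed.

Lemma dom_open : open dom.
Proof.
by apply: openU => //; rewrite openE => z; exact: resolvent_set_near.
Qed.

Lemma extension_quotient (e : C) : e = 'i \/ e = - 'i -> exists n d : C -> C,
  [/\ bt_analytic (half_plane e) n, bt_analytic (half_plane e) d,
      exists2 z, half_plane e z & d z != 0 &
      forall z, half_plane e z -> d z != 0 -> rho z /\ f z = n z / d z].
Proof.
move=> ei; have [d [bd nd dr /(_ v)[n nb nE]]] := half_plane_resolvent_set ei.
exists (fun z => ((q z0)^* + (z - z0^*) * ip v v) * d z + (z - z0^*) * (z - z0) * n z), d.
have cst c := bt_analytic_cst (half_plane e) c; have id := bt_analytic_id (unit_i ei).
split=> //.
  apply: bt_analyticD.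
    apply: bt_analyticM => //; apply: bt_analyticD => //.
    by apply: bt_analyticM => //; exact: bt_analyticB.
  by apply: bt_analyticM => //; apply: bt_analyticM; exact: bt_analyticB.
move=> z Dz dz; have rz := dr z Dz dz; split=> //.
by rewrite extensionE// realization_formulaE nE//; field.
Qed.

Lemma extension_pole p : nonreal p -> ~ dom p -> pole_or_removable f p.
Proof.
move=> /nonreal_half_plane np _.
have [e [ei Dp]] : exists e : C, (e = 'i \/ e = - 'i) /\ half_plane e p.
  by case: np => ?; [exists 'i|exists (- 'i)]; split; auto.
have [n [d [[an _] bd nd fE]]] := extension_quotient ei.
have [ad _] := bd; have [w Dw dw] := nd.
have Dn : \forall z \near p, half_plane e z.
  by apply: open_nbhs_nbhs; split=> //; apply: half_plane_open; exact: unit_i.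
apply: (@quotient_pole _ f n d p).
- by apply: filterS Dn => z Dz; exact/analytic_derivable/an.
- by apply: filterS Dn => z Dz; exact/analytic_derivable/ad.
- exact: identity_theorem ad Dw dw p Dp.
- have dn := det_neq0_near bd nd Dp.
  move: dn; rewrite !near_withinE => dn; apply: filterS2 Dn dn => z Dz dz zp.
  by have [_ ->] := fE z Dz (dz zp).
Qed.

Lemma extension_meromorphic D : open D -> D `<=` @nonreal R -> meromorphic_on D dom f.
Proof.
move=> oD Dn; split.
- exact: openI dom_open.
- by move=> z [_]; exact: extension_derivable.
- move=> p Dp lp; apply: (spectrum_discrete (Dn p Dp)) => V nV.
  have [z [zp [Dz dz] Vz]] := lp V nV; exists z; split=> //; split; last exact: Dn.
  by move=> rz; apply: dz; right.
- by move=> p /Dn; exact: extension_pole.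
Qed.

(** The combined denominator [n2 * d1] vanishes on the half-plane exactly where [d] does. Where it
    is nonzero, the point is in the resolvent set and the quotient formula applies, also at points
    of [U]. *)
Lemma extension_bounded_type (e : C) : e = 'i \/ e = - 'i ->
  half_plane e `<=` @nonreal R -> bounded_type (half_plane e) dom f.
Proof.
move=> ei en; split.
  by apply: extension_meromorphic => //; apply: half_plane_open; exact: unit_i.
have [n [d [[_ [n1 [n2 [bn1 bn2 n20 nE]]]] [_ [d1 [d2 [bd1 bd2 d20 dE]]]] [w Dw dw] fE]]] :=
  extension_quotient ei.
exists (fun z => n1 z * d2 z), (fun z => n2 z * d1 z); split.
- exact: bounded_holomorphicM.
- exact: bounded_holomorphicM.
- exists w => //; rewrite mulf_neq0 ?n20//.
  by move: dw; rewrite dE// mulf_eq0 => /norP[].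
- move=> z Dz _; rewrite mulf_eq0 => /norP[n2z d1z].
  have dz : d z != 0 by rewrite dE// mulf_neq0 ?invr_neq0 ?d20.
  have [_ ->] := fE z Dz dz.
  by rewrite nE// dE// invf_div mulf_div.
Qed.

(** Self-adjointness, applied to the pairs of [A] that define the resolvents of [v] at [z] and at
    [z^*], shows that [ip (resolvent A z v) v] is conjugated when [z] is. *)
Lemma formula_conj z : rho z -> rho z^* -> F z^* = (F z)^*.
Proof.
move=> rz rzJ; rewrite !realization_formulaE.
have [X [Y [Q [_ fd bz]]]] := resolvent_set_bounded rz.
have [X' [Y' [Q' [_ fd' bz']]]] := resolvent_set_bounded rzJ.
have Az := resolventP v bz; have AzJ := resolventP v bz'.
have /= := self_adjoint_eq Az AzJ.
rewrite (ipDl hip) (ipDr hip) (ipZl hip) (ipZr hip) conjCK => /addIr E.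
have E2 : ip (resolvent A z^* v) v = (ip (resolvent A z v) v)^*.
  by rewrite E -(ip_herm hip).
have vr : (ip v v)^* = ip v v by rewrite -(ip_herm hip).
(* At the base point the realization formula fixes the imaginary part of [q z0], which is what the
   constant term needs for the symmetry. *)
case: real => _ rz0 Uz0 /(_ z0 rz0 Uz0).
rewrite realization_formulaE subrr mulr0 mul0r addr0 => q0.
rewrite E2 !(rmorphD, rmorphM, rmorphN) /= !conjCK vr.
move: q0; move: (q z0) (q z0)^* => a b ->; ring.
Qed.

(* At points of [U] in the spectrum the symmetry follows by continuity. *)
Lemma extension_conj z : nonreal z -> dom z -> dom z^* -> f z^* = (f z)^*.
Proof.
move=> nz dz dzJ.
have cont w : dom w -> {for w, continuous f}.
  by move/extension_derivable/derivable_continuous_at.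
have nzJ : nonreal z^*.
  by move: nz; rewrite /nonreal /=; case: (z) => a b /=; rewrite oppr_eq0.
have cJ : {for z, continuous (fun w : C => w^*)} by exact: conjC_continuous.
apply: (@eq_of_punctured_nbhs _ (fun w => f w^*) (fun w => (f w)^*)).
- apply/continuous_modcP => eps e0.
  have /continuous_modcP/(_ _ e0)/near_modcP[r r0 H] := cont _ dzJ.
  by apply/near_modcP; exists r => // w wz; apply: H; rewrite -rmorphB modcJ.
- apply/continuous_modcP => eps e0.
  have /continuous_modcP/(_ _ e0) := cont _ dz.
  by apply: filterS => w; rewrite -rmorphB modcJ.
have /near_punctured_modcP[r r0 H] := resolvent_set_punctured nz.
have /near_punctured_modcP[r' r'0 H'] := resolvent_set_punctured nzJ.
apply/near_punctured_modcP; exists (Num.min r r'); first by rewrite lt_min r0.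
move=> w wz; rewrite lt_min => /andP[wr wr'].
have rw : rho w by exact: H.
have rwJ : rho w^*.
  by apply: H'; [rewrite (inj_eq (can_inj conjCK))|rewrite -rmorphB modcJ].
by rewrite !extensionE// formula_conj.
Qed.

Lemma realization_N_sym : N_sym dom f.
Proof.
have ii : ('i : C) = 'i \/ 'i = - 'i :> C by left.
have Ni : - 'i = 'i :> C \/ - 'i = - 'i :> C by right.
split.
- apply: extension_meromorphic => //; rewrite openE => z.
  rewrite /interior => /nonreal_half_plane[] Dz.
  + have : \forall w \near z, half_plane ('i : C) w.
      by apply: open_nbhs_nbhs; split=> //; apply: half_plane_open; exact: unit_i.
    by apply: filterS => w; rewrite half_plane_i /nonreal /= => /lt_eqF ->.
  + have : \forall w \near z, half_plane (- 'i : C) w.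
      by apply: open_nbhs_nbhs; split=> //; apply: half_plane_open; exact: unit_i.
    by apply: filterS => w; rewrite half_plane_Ni /nonreal /= => /gt_eqF ->.
- rewrite -half_plane_Ni; apply: extension_bounded_type => // w.
  by rewrite half_plane_Ni /nonreal /= => /gt_eqF ->.
- rewrite -half_plane_i; apply: extension_bounded_type => // w.
  by rewrite half_plane_i /nonreal /= => /lt_eqF ->.
- exact: extension_conj.
Qed.

End PartiallyFundamentallyReducible.

Unset Implicit Arguments.

Theorem theorem5p5 (R : realType) (K : lmodType R[i])
    (form : {hermitian K for false & (@Num.conj R[i] : R[i] -> R[i])})
    (A : set (K * K)) :
  krein_space form ->
  partially_fundamentally_reducible form A ->
  discrete_in (@nonreal R) (spectrum form A `&` @nonreal R) /\
  (forall (v : K) (U : set R[i]) (q : R[i] -> R[i]) (z0 : R[i]),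
     open U -> holomorphic_on U q ->
     is_realization form A v U q z0 ->
     N_sym (U `|` resolvent_set form A)
       (realization_extension form A v U q z0)).
Proof.
move=> _ pfr.
have hip : hermitian_form form.
  by split=> [a x y z|x y]; [rewrite linearPl|rewrite hermC expr0 mul1r].
split; first exact: spectrum_discrete pfr.
by move=> v U q z0; exact: realization_N_sym.
Qed.
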